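(* Let $\Upsilon=\Upsilon(\underline{\psi},\underline{\delta})$ be a triangular $\mathbf{t}$-module of dimension $n$. Then (i) $\Upsilon$ is finite and therefore also abelian; (ii) $\Upsilon$ is pure if and only if $\operatorname{rk}\psi_1=\dots=\operatorname{rk}\psi_n$.
   Context: Let $A=\mathbb F_q[t]$, $K$ an $A$-field with $\theta$ the image of $t$, $K\{\tau\}$ the twisted polynomial ring ($\tau c=c^q\tau$). A $\mathbf{t}$-module of dimension $d$ is an $\mathbb F_q$-algebra homomorphism $\Phi:A\to\mathrm{Mat}_d(K\{\tau\})$ with constant term of $\Phi_t$ equal to $\theta I_d+N$, $N$ nilpotent. A Drinfeld module is a $\mathbf{t}$-module $\psi$ of dimension $1$ with $\psi_t=\theta+a_1\tau+\dots+a_r\tau^r$, $a_r\ne0$, $r\ge1$, $\operatorname{rk}\psi=r$. Triangular $\mathbf{t}$-module $\Upsilon(\underline\psi,\underline\delta)$: with rows and columns indexed $n,\dots,1$ from top to bottom and left to right, $\Upsilon_t$ is lower triangular with diagonal entry $\psi_{k,t}$ at $(k,k)$ for Drinfeld modules $\psi_k$, entry $\delta_{i\times j}\in K\{\tau\}$ in row $i$, column $j$ for $i<j$, zeros elsewhere. The $\mathbf{t}$-motive of $\Phi$ is $M(\Phi)=\operatorname{Hom}_{\mathbb F_q}(\mathbb G_a^d,\mathbb G_a)\cong K\{\tau\}^{1\times d}$, a left module over $K[t,\tau]$ (with $t$ central, $\tau c=c^q\tau$) via $(ct^i)\cdot m=c\,m\,\Phi_{t^i}$. $\Phi$ is abelian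 if $M(\Phi)$ is free and finitely generated over $K[t]$. For $K$ perfect, the $\mathbf{t}$-comotive is $N(\Phi)=\operatorname{Hom}_{\mathbb F_q}(\mathbb G_a,\mathbb G_a^d)\cong K\{\sigma\}^d$, a left $K[t,\sigma]$-module ($\sigma c=c^{1/q}\sigma$) with $t$ acting through $\Phi_t^{*}$, where $*$ is the anti-isomorphism $\sum a_i\tau^i\mapsto\sum\sigma^ia_i$ extended to matrices by transposition; $\Phi$ is finite if $N(\Phi)$ is free and finitely generated over $K[t]$. An abelian $\Phi$ (with motive $M$) is pure if $M((1/t)):=M\otimes_{K[t]}K((1/t))$ contains a finitely generated $K[[1/t]]$-submodule $H$ generating it over $K((1/t))$ with $t^uH=\tau^vH$ for some positive integers $u,v$.
   Formalization: Over imperfect K, where equality of sets fails even for the Carlitz module, τ^vH in the definition of pure means the K[[1/t]]-submodule generated by τ^vH (the same for perfect K); finiteness is asserted when K is perfect, as the comotive requires, and the rest for every K. *)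

(* Defs.v *)
From HB Require Import structures.
From mathcomp Require Import all_boot all_order all_algebra all_fingroup.
From mathcomp Require Import all_solvable all_field.
From mathcomp Require Import finmap generic_quotient.
From mathcomp Require Import boolp classical_sets functions fsbigop.
From mathcomp Require Import zify.

Set Implicit Arguments.
Unset Strict Implicit.
Unset Printing Implicit Defensive.
Import Order.TTheory GRing.Theory Num.Theory.
Local Open Scope classical_set_scope.
Local Open Scope ring_scope.
Local Open Scope quotient_scope.

(* Coefficients of (sum_i a_i X^i)(sum_j b_j X^j) when X c = phi(c) X. *)
Section Convolution.
Variables (R : pzRingType) (phi : {rmorphism R -> R}).
Implicit Types a b c : nat -> R.

Definition conv a b (n : nat) : R :=
  \sum_(i < n.+1) a i * iter i phi (b (n - i)%N).

Lemma iter_phi0 i : iter i phi 0 = 0.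
Proof. by elim: i => //= i ->; rewrite rmorph0. Qed.
Lemma iter_phi1 i : iter i phi 1 = 1.
Proof. by elim: i => //= i ->; rewrite rmorph1. Qed.
Lemma iter_phiD i x y : iter i phi (x + y) = iter i phi x + iter i phi y.
Proof. by elim: i => //= i ->; rewrite rmorphD. Qed.
Lemma iter_phiM i x y : iter i phi (x * y) = iter i phi x * iter i phi y.
Proof. by elim: i => //= i ->; rewrite rmorphM. Qed.
Lemma iter_phi_sum i I (r : seq I) (P : pred I) F :
  iter i phi (\sum_(j <- r | P j) F j) = \sum_(j <- r | P j) iter i phi (F j).
Proof. exact: (big_morph _ (iter_phiD i) (iter_phi0 i)). Qed.

Lemma eq_conv a a' b b' : a =1 a' -> b =1 b' -> conv a b =1 conv a' b'.
Proof. by move=> ea eb n; apply: eq_bigr => i _; rewrite ea eb. Qed.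

Lemma convA a b c : conv a (conv b c) =1 conv (conv a b) c.
Proof.
move=> n; rewrite /conv.
under [RHS]eq_bigr => i _.
  rewrite mulr_suml (big_ord_widen n.+1 (fun k => a k * iter k phi (b (i - k)%N)
     * iter i phi (c (n - i)%N))) //.
  over.
rewrite (exchange_big_dep xpredT) //=; apply: eq_bigr => k _.
rewrite iter_phi_sum mulr_sumr.
rewrite -(big_mkord xpredT (fun j => a k * iter k phi (b j *
   iter j phi (c (n - k - j)%N)))).
transitivity (\sum_(0 <= i < n.+1 | true && (k <= i)%N)
   a k * iter k phi (b (i - k)%N) * iter i phi (c (n - i)%N)); last first.
  by rewrite big_mkord; apply: eq_bigl => i; rewrite ltnS.
rewrite -(@big_nat_widenl _ _ _ k 0%N n.+1) //.
have -> : index_iota k n.+1 = index_iota (0 + k) n.+1 by rewrite add0n.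
have kn : (k <= n)%N by rewrite -ltnS.
rewrite [RHS]big_addn subSn //.
apply: eq_big_nat => j _; rewrite addnK iter_phiM -iterD mulrA (addnC j).
by rewrite subnDA.
Qed.

Lemma convDl a a' b n : conv (fun i => a i + a' i) b n = conv a b n + conv a' b n.
Proof. by rewrite -big_split; apply: eq_bigr => i _; rewrite mulrDl. Qed.
Lemma convDr a b b' n : conv a (fun i => b i + b' i) n = conv a b n + conv a b' n.
Proof. by rewrite -big_split; apply: eq_bigr => i _; rewrite iter_phiD mulrDr. Qed.
Lemma conv1l b n : conv (fun i => (i == 0%N)%:R) b n = b n.
Proof.
rewrite /conv big_ord_recl /= mul1r subn0 big1 ?addr0 // => i _.
by rewrite mul0r.
Qed.
Lemma conv1r a n : conv a (fun i => (i == 0%N)%:R) n = a n.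
Proof.
rewrite /conv big_ord_recr /= subnn iter_phi1 mulr1 big1 ?add0r // => i _.
by rewrite subn_eq0 leqNgt ltn_ord iter_phi0 mulr0.
Qed.
End Convolution.

Lemma convC (R : comPzRingType) (a b : nat -> R) n : conv idfun a b n = conv idfun b a n.
Proof.
rewrite /conv (reindex_inj rev_ord_inj) /=; apply: eq_bigr => i _.
have it (k : nat) (x : R) : iter k idfun x = x by elim: k => //= k ->.
by rewrite !it mulrC subSS subKn // -ltnS.
Qed.

(* R{X} with X c = phi(c) X, by left coefficients: SkewPoly p is sum_i p`_i X^i.
   A wrapper, so that the commutative product of {poly R} cannot be inferred. *)
Record skewpoly (R : nzRingType) (phi : {rmorphism R -> R}) :=
  SkewPoly { skewval : {poly R} }.

Section SkewDef.
Variables (R : nzRingType) (phi : {rmorphism R -> R}).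
Local Notation skewpoly := (skewpoly phi).
Local Notation SkewPoly := (@SkewPoly R phi).

HB.instance Definition _ := [isNew for @skewval R phi].
HB.instance Definition _ := [Choice of skewpoly by <:].

Let zero := SkewPoly 0.
Let opp (p : skewpoly) := SkewPoly (- skewval p).
Let add (p q : skewpoly) := SkewPoly (skewval p + skewval q).
Let addA : associative add. Proof. by move=> p q r; congr SkewPoly; rewrite addrA. Qed.
Let addC : commutative add. Proof. by move=> p q; congr SkewPoly; rewrite addrC. Qed.
Let add0 : left_id zero add. Proof. by move=> [p]; congr SkewPoly; rewrite add0r. Qed.
Let addN : left_inverse zero opp add.
Proof. by move=> p; congr SkewPoly; rewrite addNr. Qed.
HB.instance Definition _ := GRing.isZmodule.Build skewpoly addA addC add0 addN.

Implicit Types p q : skewpoly.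

Definition skewC (c : R) : skewpoly := SkewPoly c%:P.
Definition skewX : skewpoly := SkewPoly 'X.
Definition skewcoef p (i : nat) : R := (skewval p)`_i.
Definition skewsize p : nat := size (skewval p).

Definition skewmul p q : skewpoly :=
  SkewPoly (\poly_(n < skewsize p + skewsize q)
    \sum_(i < n.+1) skewcoef p i * iter i phi (skewcoef q (n - i))).

Lemma skewcoefP p q : skewcoef p =1 skewcoef q -> p = q.
Proof. by move=> e; apply: val_inj; apply/polyP. Qed.
Lemma skewcoefD p q i : skewcoef (p + q) i = skewcoef p i + skewcoef q i.
Proof. exact: coefD. Qed.
Lemma skewcoefC c i : skewcoef (skewC c) i = if i == 0%N then c else 0.
Proof. exact: coefC. Qed.

Lemma skewcoef_mul p q : skewcoef (skewmul p q) =1 conv phi (skewcoef p) (skewcoef q).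
Proof.
move=> n; rewrite /skewcoef coef_poly; case: ltnP => // len.
rewrite /conv big1 // => i _.
have [lip|lip] := leqP (size (skewval p)) i; first by rewrite nth_default ?mul0r.
rewrite [X in iter _ _ X]nth_default ?iter_phi0 ?mulr0 //.
rewrite -(leq_add2l i) subnKC; last by rewrite -ltnS.
by apply: leq_trans len; rewrite leq_add2r ltnW.
Qed.

Let mulA : associative skewmul.
Proof.
move=> p q r; apply: skewcoefP => n; rewrite !skewcoef_mul.
rewrite (eq_conv phi (fun=> erefl) (skewcoef_mul q r)).
by rewrite [RHS](eq_conv phi (skewcoef_mul p q) (fun=> erefl)) convA.
Qed.
Let skewcoef1 i : skewcoef (skewC 1) i = (i == 0%N)%:R.
Proof. by rewrite skewcoefC; case: eqP. Qed.
Let mul1 : left_id (skewC 1) skewmul.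
Proof.
move=> p; apply: skewcoefP => n; rewrite skewcoef_mul.
by rewrite (eq_conv phi skewcoef1 (fun=> erefl)) conv1l.
Qed.
Let mulr1_ : right_id (skewC 1) skewmul.
Proof.
move=> p; apply: skewcoefP => n; rewrite skewcoef_mul.
by rewrite (eq_conv phi (fun=> erefl) skewcoef1) conv1r.
Qed.
Let mulDl : left_distributive skewmul +%R.
Proof.
move=> p q r; apply: skewcoefP => n; rewrite skewcoefD !skewcoef_mul -convDl.
by apply: eq_conv => // i; rewrite skewcoefD.
Qed.
Let mulDr : right_distributive skewmul +%R.
Proof.
move=> p q r; apply: skewcoefP => n; rewrite skewcoefD !skewcoef_mul -convDr.
by apply: eq_conv => // i; rewrite skewcoefD.
Qed.
Let one_neq0 : skewC 1 != 0.
Proof.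
apply/eqP => /(congr1 (skewcoef^~ 0%N)); rewrite skewcoefC /skewcoef coef0.
by move/eqP; rewrite oner_eq0.
Qed.
HB.instance Definition _ := GRing.Zmodule_isNzRing.Build skewpoly
  mulA mul1 mulr1_ mulDl mulDr one_neq0.

Lemma skewcoefM p q n : skewcoef (p * q) n =
  \sum_(i < n.+1) skewcoef p i * iter i phi (skewcoef q (n - i)).
Proof. exact: skewcoef_mul. Qed.

Lemma skewC_is_additive : zmod_morphism skewC.
Proof. by move=> a b; apply: val_inj; rewrite /= polyCB. Qed.
Lemma skewC_is_monoid : monoid_morphism skewC.
Proof.
split=> // a b; apply: skewcoefP => n; rewrite skewcoefM skewcoefC.
rewrite big_ord_recl /= !skewcoefC /= subn0 big1 => [|i _]; last first.
  by rewrite skewcoefC mul0r.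
by rewrite addr0; case: eqP; rewrite ?mulr0.
Qed.
HB.instance Definition _ := GRing.isZmodMorphism.Build R skewpoly skewC skewC_is_additive.
HB.instance Definition _ := GRing.isMonoidMorphism.Build R skewpoly skewC skewC_is_monoid.


Lemma skewcoefX i : skewcoef skewX i = (i == 1%N)%:R.
Proof. exact: coefX. Qed.

Lemma skewXC c : skewX * skewC c = skewC (phi c) * skewX.
Proof.
apply: skewcoefP => n; rewrite !skewcoefM big_ord_recl [RHS]big_ord_recl /=.
rewrite skewcoefC !skewcoefX /= subn0 mul0r add0r [X in _ + X]big1 ?addr0; last first.
  by move=> i _; rewrite skewcoefC mul0r.
case: n => [|n]; first by rewrite big_ord0 mulr0.
rewrite big_ord_recl /= skewcoefX mul1r big1 ?addr0 => [|i _]; last first.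
  by rewrite skewcoefX mul0r.
rewrite skewcoefC subSS subn0 skewcoefC.
by case: n => [|n] /=; rewrite ?mulr1 ?rmorph0 ?mulr0.
Qed.
End SkewDef.

Lemma fsum_seqE (V : nmodType) (I : choiceType) (F : I -> V) (s : seq I) :
    uniq s -> (forall i, i \notin s -> F i = 0) ->
  \sum_(i \in [set: I]) F i = \sum_(i <- s) F i.
Proof.
move=> us Fs; rewrite (@fsbigTE _ _ _ _ [fset x in s]%fset) => [|i]; last first.
  by rewrite in_fset; apply: Fs.
by apply/perm_big/uniq_perm; rewrite ?fset_uniq // => x; rewrite in_fset.
Qed.

(* R((1/t)): the families of coefficients of t^i, i : int, that vanish for
   large i. *)
Section LaurentDef.
Variable R : comNzRingType.

Definition bounded_above (f : int -> R) : Prop :=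
  exists N : int, forall i, N < i -> f i = 0.

Record laurent := Laurent {
  lcoef :> int -> R;
  _ : `[< bounded_above lcoef >] }.

HB.instance Definition _ := [isSub for lcoef].
HB.instance Definition _ := [Choice of laurent by <:].

Implicit Types f g h : laurent.

Lemma laurentP f g : f =1 g -> f = g.
Proof. by move=> e; apply: val_inj; apply: funext. Qed.

Lemma lboundP f : bounded_above f.
Proof. by case: f => f /= /asboolP. Qed.

Lemma bounded_above_le (f : int -> R) (N M : int) :
  (forall i, N < i -> f i = 0) -> N <= M -> forall i, M < i -> f i = 0.
Proof. by move=> fN NM i Mi; apply: fN; apply: le_lt_trans Mi. Qed.

Definition mklaurent (f : int -> R) (Hf : bounded_above f) : laurent :=
  Laurent (asboolT Hf).

Lemma lbound0 : bounded_above (fun=> 0). Proof. by exists 0. Qed.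
Lemma lboundN f : bounded_above (fun i => - f i).
Proof. by have [N fN] := lboundP f; exists N => i /fN ->; rewrite oppr0. Qed.
Lemma lboundD f g : bounded_above (fun i => f i + g i).
Proof.
have [N fN] := lboundP f; have [M gM] := lboundP g.
by exists (Num.max N M) => i; rewrite gt_max => /andP[/fN -> /gM ->]; rewrite addr0.
Qed.

Let addA : associative (fun f g => mklaurent (lboundD f g)).
Proof. by move=> f g h; apply: laurentP => i /=; rewrite addrA. Qed.
Let addC : commutative (fun f g => mklaurent (lboundD f g)).
Proof. by move=> f g; apply: laurentP => i /=; rewrite addrC. Qed.
Let add0 : left_id (mklaurent lbound0) (fun f g => mklaurent (lboundD f g)).
Proof. by move=> f; apply: laurentP => i /=; rewrite add0r. Qed.
Let addN : left_inverse (mklaurent lbound0) (fun f => mklaurent (lboundN f))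
  (fun f g => mklaurent (lboundD f g)).
Proof. by move=> f; apply: laurentP => i /=; rewrite addNr. Qed.
HB.instance Definition _ := GRing.isZmodule.Build laurent addA addC add0 addN.

Lemma lcoefD f g i : (f + g) i = f i + g i. Proof. by []. Qed.

Definition lmulcoef (f g : int -> R) (n : int) : R :=
  \sum_(i \in [set: int]) f i * g (n - i).

Section MulE.
Variables (f g : int -> R) (a b : int).
Hypotheses (fa : forall i, a < i -> f i = 0) (gb : forall i, b < i -> g i = 0).

Lemma lmulcoef_gt n : a + b < n -> lmulcoef f g n = 0.
Proof.
move=> abn; rewrite /lmulcoef (@fsum_seqE _ _ _ [::]) ?big_nil // => i _.
have [ai|ia] := ltP a i; first by rewrite fa ?mul0r.
by rewrite gb ?mulr0 //; lia.
Qed.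

Lemma lmulcoef_le (m : nat) : lmulcoef f g (a + b - m%:Z) =
  conv idfun (fun k => f (a - k%:Z)) (fun k => g (b - k%:Z)) m.
Proof.
pose s := [seq a - k%:Z | k <- iota 0 m.+1].
have us : uniq s by rewrite map_inj_uniq ?iota_uniq // => x y; lia.
rewrite /lmulcoef (fsum_seqE us) => [|i nis]; last first.
  have [ai|ia] := ltP a i; first by rewrite fa ?mul0r.
  have [lb|lb] := ltP b (a + b - m%:Z - i); first by rewrite [X in _ * X]gb ?mulr0.
  case/negP: nis; apply/mapP; exists (absz (a - i)%R); last by lia.
  by rewrite mem_iota; lia.
rewrite big_map -[iota 0 m.+1]/(index_iota 0 m.+1) big_mkord.
apply: eq_bigr => i _; congr (_ * _).
have it (k : nat) (x : R) : iter k idfun x = x by elim: k => //= k ->.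
by rewrite it; congr (g _); have := ltn_ord i; lia.
Qed.
End MulE.

Lemma lboundM f g : bounded_above (lmulcoef f g).
Proof.
have [a fa] := lboundP f; have [b gb] := lboundP g.
by exists (a + b); apply: lmulcoef_gt.
Qed.

Definition lmul f g : laurent := mklaurent (lboundM f g).

Let mulA : associative lmul.
Proof.
move=> f g h; apply: laurentP => n /=.
have [a fa] := lboundP f; have [b gb] := lboundP g; have [c hc] := lboundP h.
have fgab := lmulcoef_gt fa gb; have ghbc := lmulcoef_gt gb hc.
have [n_gt|n_le] := ltP (a + b + c) n.
  by rewrite (lmulcoef_gt fa ghbc) ?(lmulcoef_gt fgab hc) // addrA.
pose m := absz (a + b + c - n)%R.
have -> : n = a + b + c - m%:Z by rewrite /m; lia.
rewrite (lmulcoef_le fgab hc) -(addrA a b c) (lmulcoef_le fa ghbc).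
rewrite (eq_conv _ (fun=> erefl) (fun k => lmulcoef_le gb hc k)).
by rewrite convA; apply: eq_conv => // k; rewrite (lmulcoef_le fa gb).
Qed.

Let mulC : commutative lmul.
Proof.
move=> f g; apply: laurentP => n /=.
have [a fa] := lboundP f; have [b gb] := lboundP g.
have [n_gt|n_le] := ltP (a + b) n.
  by rewrite (lmulcoef_gt fa gb) ?(lmulcoef_gt gb fa) // addrC.
pose m := absz (a + b - n)%R.
have -> : n = a + b - m%:Z by rewrite /m; lia.
by rewrite (lmulcoef_le fa gb) (addrC a b) (lmulcoef_le gb fa) convC.
Qed.

Let mulDl : left_distributive lmul +%R.
Proof.
move=> f g h; apply: laurentP => n; rewrite lcoefD /=.
have [a' fa'] := lboundP f; have [b' gb'] := lboundP g; have [c hc] := lboundP h.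
pose a := Num.max a' b'.
have fa : forall i, a < i -> f i = 0.
  by apply: (bounded_above_le fa'); rewrite le_max lexx.
have ga : forall i, a < i -> g i = 0.
  by apply: (bounded_above_le gb'); rewrite le_max lexx orbT.
have fga : forall i, a < i -> (f + g) i = 0.
  by move=> i ai; rewrite lcoefD fa ?ga ?addr0.
have [n_gt|n_le] := ltP (a + c) n.
  by rewrite (lmulcoef_gt fga hc) ?(lmulcoef_gt fa hc) ?(lmulcoef_gt ga hc) ?addr0.
pose m := absz (a + c - n)%R.
have -> : n = a + c - m%:Z by rewrite /m; lia.
by rewrite (lmulcoef_le fga hc) (lmulcoef_le fa hc) (lmulcoef_le ga hc) -convDl.
Qed.

Lemma lbound_mono (c : R) (d : int) : bounded_above (fun i => if i == d then c else 0).
Proof. by exists d => i di; rewrite gt_eqF. Qed.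

(* c t^d *)
Definition lmono (c : R) (d : int) : laurent := mklaurent (lbound_mono c d).

Let mul1 : left_id (lmono 1 0) lmul.
Proof.
move=> f; apply: laurentP => n /=.
rewrite /lmulcoef (@fsum_seqE _ _ _ [:: 0]) // => [|i]; last first.
  by rewrite inE => /negPf ->; rewrite mul0r.
by rewrite big_seq1 eqxx mul1r subr0.
Qed.

Let one_neq0 : lmono 1 0 != 0.
Proof.
apply/eqP => /(congr1 (fun f : laurent => f 0)) /= /eqP.
by rewrite oner_eq0.
Qed.

HB.instance Definition _ := GRing.Zmodule_isComNzRing.Build laurent
  mulA mulC mul1 mulDl one_neq0.

Lemma lcoefM f g n : (f * g) n = \sum_(i \in [set: int]) f i * g (n - i).
Proof. by []. Qed.

Definition lpoly_coef (p : {poly R}) (i : int) : R := if i is Posz n then p`_n else 0.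
Lemma lbound_poly p : bounded_above (lpoly_coef p).
Proof.
exists (size p)%:Z => -[n|n] //=; rewrite ltz_nat => /ltnW sn.
by rewrite nth_default.
Qed.
(* the embedding of R[t] in R((1/t)) *)
Definition lpoly (p : {poly R}) : laurent := mklaurent (lbound_poly p).

Lemma lpoly_is_additive : zmod_morphism lpoly.
Proof.
move=> p q; apply: laurentP => -[n|n]; rewrite lcoefD /= ?coefB //.
by rewrite oppr0 addr0.
Qed.
Lemma lpoly_is_monoid : monoid_morphism lpoly.
Proof.
split=> [|p q]; apply: laurentP.
  by move=> [n|n] //=; rewrite coef1; case: n => [|n].
move=> [n|n]; rewrite lcoefM /=.
  have us : uniq [seq k%:Z | k <- iota 0 n.+1].
    by rewrite map_inj_uniq ?iota_uniq // => x y; lia.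
  rewrite coefM (fsum_seqE us) => [|i ni]; last first.
    have [i0|i0] := ltP i 0; first by case: i i0 {ni} => // i _; rewrite mul0r.
    have [ni'|ni'] := ltP n%:Z i.
      have [k ->] : exists k, n%:Z - i = Negz k by exists (absz (i - n%:Z)%R).-1; lia.
      by rewrite mulr0.
    case/negP: ni; apply/mapP; exists (absz i); last by lia.
    by rewrite mem_iota; lia.
  rewrite big_map -[iota 0 n.+1]/(index_iota 0 n.+1) big_mkord.
  apply: eq_bigr => i _ /=; congr (_ * _).
  by rewrite subzn // -ltnS.
rewrite (@fsum_seqE _ _ _ [::]) ?big_nil // => -[k|k] _ /=; last by rewrite mul0r.
have [j ->] : exists j, Negz n - k%:Z = Negz j by exists (n + k)%N; lia.
by rewrite mulr0.
Qed.
HB.instance Definition _ := GRing.isZmodMorphism.Build {poly R} laurent lpoly lpoly_is_additive.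
HB.instance Definition _ := GRing.isMonoidMorphism.Build {poly R} laurent lpoly lpoly_is_monoid.

(* R[[1/t]] inside R((1/t)) *)
Definition lint : set laurent := [set f | forall i, 0 < i -> f i = 0].

End LaurentDef.

Section LaurentMap.
Variables (R : comNzRingType) (phi : {rmorphism R -> R}).
Lemma lbound_map (f : laurent R) : bounded_above (fun i => phi (f i)).
Proof. by have [N fN] := lboundP f; exists N => i /fN ->; rewrite rmorph0. Qed.
(* phi applied to the coefficients; in particular t |-> t *)
Definition lmap (f : laurent R) : laurent R := mklaurent (lbound_map f).

Lemma lmap_is_additive : zmod_morphism lmap.
Proof. by move=> f g; apply: laurentP => i; rewrite /= rmorphB. Qed.
Lemma lmap_is_monoid : monoid_morphism lmap.
Proof.
split=> [|f g]; apply: laurentP => n /=.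
  by case: eqP; rewrite ?rmorph1 ?rmorph0.
have [a fa] := lboundP f; have [b gb] := lboundP g.
have fa' i : a < i -> lmap f i = 0 by move=> /fa /= ->; rewrite rmorph0.
have gb' i : b < i -> lmap g i = 0 by move=> /gb /= ->; rewrite rmorph0.
have [n_gt|n_le] := ltP (a + b) n.
  by rewrite (lmulcoef_gt fa gb) ?(lmulcoef_gt fa' gb') ?rmorph0.
pose m := absz (a + b - n)%R.
have -> : n = a + b - m%:Z by rewrite /m; lia.
rewrite (lmulcoef_le fa gb) (lmulcoef_le fa' gb') /conv rmorph_sum.
have it (k : nat) (x : R) : iter k idfun x = x by elim: k => //= k ->.
by apply: eq_bigr => i _; rewrite rmorphM /= !it.
Qed.
HB.instance Definition _ := GRing.isZmodMorphism.Build (laurent R) (laurent R) lmap lmap_is_additive.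
HB.instance Definition _ := GRing.isMonoidMorphism.Build (laurent R) (laurent R) lmap lmap_is_monoid.
Lemma lmap_poly (p : {poly R}) : lmap (lpoly p) = lpoly (map_poly phi p).
Proof. by apply: laurentP => -[n|n] /=; rewrite ?coef_map ?rmorph0. Qed.
End LaurentMap.

Section LinearAlgebra.
Variables (R : nzRingType) (V : lmodType R).
(* Linear combinations of elements of B with coefficients in the subring C. *)
Definition lincomb (C : set R) (B : set V) : set V :=
  [set v | exists (s : seq V) (c : V -> R),
    (forall x, x \in s -> B x /\ C (c x)) /\ v = \sum_(x <- s) c x *: x].
Definition generating (B : set V) : Prop := lincomb setT B = setT.
Definition lin_independent (B : set V) : Prop :=
  forall (s : seq V) (c : V -> R), uniq s -> (forall x, x \in s -> B x) ->
    \sum_(x <- s) c x *: x = 0 -> forall x, x \in s -> c x = 0.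
Definition free_module : Prop := exists B : set V, generating B /\ lin_independent B.
Definition fin_generated : Prop := exists s : seq V, generating [set` s].
Definition submodule_over (C : set R) (H : set V) : Prop :=
  [/\ H 0, forall x y, H x -> H y -> H (x + y)
    & forall c x, C c -> H x -> H (c *: x)].
Definition fin_generated_over (C : set R) (H : set V) : Prop :=
  exists s : seq V, H = lincomb C [set` s].
End LinearAlgebra.
Arguments free_module {R} V.
Arguments fin_generated {R} V.

(* The S-module M (x)_R S, for S an R-algebra via iota: finite formal sums
   (as sequences) of pairs (m, x), modulo the congruence generated by the
   relations of the tensor product. *)
Section BaseChange.
Variables (R S : comNzRingType) (iota : {rmorphism R -> S}) (M : lmodType R).

Inductive tens_rel : seq (M * S) -> seq (M * S) -> Prop :=
| TensRefl s : tens_rel s s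
| TensSym s1 s2 : tens_rel s1 s2 -> tens_rel s2 s1
| TensTrans s1 s2 s3 : tens_rel s1 s2 -> tens_rel s2 s3 -> tens_rel s1 s3
| TensCat s1 s2 s1' s2' :
    tens_rel s1 s1' -> tens_rel s2 s2' -> tens_rel (s1 ++ s2) (s1' ++ s2')
| TensC s1 s2 : tens_rel (s1 ++ s2) (s2 ++ s1)
| Tens0 x : tens_rel [:: (0, x)] [::]
| TensDl m m' x : tens_rel [:: (m + m', x)] [:: (m, x); (m', x)]
| TensDr m x x' : tens_rel [:: (m, x + x')] [:: (m, x); (m, x')]
| TensZ a m x : tens_rel [:: (a *: m, x)] [:: (m, iota a * x)].

Definition tens_eq : rel (seq (M * S)) := fun s1 s2 => `[< tens_rel s1 s2 >].

Lemma tens_eq_refl : reflexive tens_eq.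
Proof. by move=> s; apply/asboolP/TensRefl. Qed.
Lemma tens_eq_sym : symmetric tens_eq.
Proof. by move=> s1 s2; apply/asboolP/asboolP; apply: TensSym. Qed.
Lemma tens_eq_trans : transitive tens_eq.
Proof.
by move=> s2 s1 s3 /asboolP h /asboolP h'; apply/asboolP; apply: TensTrans h h'.
Qed.
Canonical tens_equiv := EquivRel tens_eq tens_eq_refl tens_eq_sym tens_eq_trans.

Definition basechange := {eq_quot tens_eq}.
HB.instance Definition _ : EqQuotient _ tens_eq basechange := EqQuotient.on basechange.
HB.instance Definition _ := Choice.on basechange.

Definition tensor (m : M) (x : S) : basechange := \pi_basechange [:: (m, x)].

Lemma tens_piP s1 s2 : tens_rel s1 s2 <-> \pi_basechange s1 = \pi_basechange s2.
Proof.
split=> [h|/eqmodP /= /asboolP //].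
by apply/eqmodP => /=; apply/asboolP.
Qed.

Lemma tens_reprK s : tens_rel (repr (\pi_basechange s)) s.
Proof. by apply/tens_piP; rewrite reprK. Qed.

Lemma tens_rel_map (phi : {rmorphism R -> R}) (f : M -> M) (g : S -> S) :
  zmod_morphism f -> zmod_morphism g ->
  (forall a m, f (a *: m) = phi a *: f m) ->
  (forall a x, g (iota a * x) = iota (phi a) * g x) ->
  forall s1 s2, tens_rel s1 s2 ->
  tens_rel [seq (f p.1, g p.2) | p <- s1] [seq (f p.1, g p.2) | p <- s2].
Proof.
move=> fB gB fZ gZ s1 s2.
have f0 : f 0 = 0 by have := fB 0 0; rewrite !subrr.
have fD x y : f (x + y) = f x + f y by have := fB (x + y) y; rewrite addrK => ->; rewrite subrK.
have gD x y : g (x + y) = g x + g y by have := gB (x + y) y; rewrite addrK => ->; rewrite subrK.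
elim=> {s1 s2} /=.
- by move=> s; apply: TensRefl.
- by move=> s1 s2 _; apply: TensSym.
- by move=> s1 s2 s3 _ h _; apply: TensTrans h.
- by move=> s1 s2 s1' s2' _ h _ h'; rewrite !map_cat; apply: TensCat.
- by move=> s1 s2; rewrite !map_cat; apply: TensC.
- by move=> x; rewrite f0; apply: Tens0.
- by move=> m m' x; rewrite fD; apply: TensDl.
- by move=> m x x'; rewrite gD; apply: TensDr.
- by move=> a m x; rewrite fZ gZ; apply: TensZ.
Qed.

Definition bc_add (x y : basechange) : basechange := \pi_basechange (repr x ++ repr y).
Definition bc_opp (x : basechange) : basechange := \pi_basechange [seq (- p.1, p.2) | p <- repr x].
Definition bc_zero : basechange := \pi_basechange [::].
Definition bc_scale (a : S) (x : basechange) : basechange :=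
  \pi_basechange [seq (p.1, a * p.2) | p <- repr x].

Let addE s1 s2 : bc_add (\pi_basechange s1) (\pi_basechange s2) = \pi_basechange (s1 ++ s2).
Proof. by apply/tens_piP; apply: TensCat; apply: tens_reprK. Qed.
Let scaleE a s : bc_scale a (\pi_basechange s) = \pi_basechange [seq (p.1, a * p.2) | p <- s].
Proof.
apply/tens_piP; apply: (@tens_rel_map idfun idfun (fun x => a * x)) => //=.
- by move=> x y; rewrite mulrBr.
- by move=> b x; rewrite mulrCA.
- exact: tens_reprK.
Qed.

Let addA : associative bc_add.
Proof.
by elim/quotW=> x; elim/quotW=> y; elim/quotW=> z; rewrite (addE y z) (addE x y) !addE catA.
Qed.
Let addC : commutative bc_add.
Proof.
by elim/quotW=> x; elim/quotW=> y; rewrite !addE; apply/tens_piP/TensC.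
Qed.
Let add0 : left_id bc_zero bc_add.
Proof. by elim/quotW=> x; rewrite /bc_zero addE. Qed.
Let addN : left_inverse bc_zero bc_opp bc_add.
Proof.
move=> x; rewrite -{2}[x]reprK addE; apply/tens_piP.
elim: (repr x) => [|[m a] s IH] /=; first exact: TensRefl.
rewrite -[_ :: _ ++ _]/([:: (- m, a)] ++ (map (fun p => (- p.1, p.2)) s ++ (m, a) :: s)).
apply: TensTrans (TensCat (TensRefl _) (TensC _ _)) _.
rewrite -[((m, a) :: s) ++ _]/([:: (m, a)] ++ (s ++ map (fun p => (- p.1, p.2)) s)) catA.
rewrite -[[::]]/([::] ++ [::] : seq (M * S)); apply: TensCat => /=.
  by apply: TensTrans (TensSym (TensDl _ _ _)) _; rewrite addNr; apply: Tens0.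
by apply: TensTrans (TensC _ _) IH.
Qed.
HB.instance Definition _ := GRing.isZmodule.Build basechange addA addC add0 addN.

Lemma pi_cat s1 s2 : \pi_basechange (s1 ++ s2) = \pi_basechange s1 + \pi_basechange s2.
Proof. by rewrite -addE. Qed.

Let scaleA a b v : bc_scale a (bc_scale b v) = bc_scale (a * b) v.
Proof.
elim/quotW: v => s; rewrite (scaleE b) !scaleE -map_comp; congr \pi_basechange.
by apply: eq_map => p /=; rewrite mulrA.
Qed.
Let scale1 : left_id 1 bc_scale.
Proof.
elim/quotW=> s; rewrite scaleE; congr \pi_basechange; rewrite -[RHS]map_id.
by apply: eq_map => -[m x] /=; rewrite mul1r.
Qed.
Let scaleDr : right_distributive bc_scale +%R.
Proof.
move=> a; elim/quotW=> s1; elim/quotW=> s2.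
by rewrite -pi_cat !scaleE map_cat pi_cat.
Qed.
Let scaleDl v : {morph bc_scale^~ v : a b / a + b}.
Proof.
move=> a b; elim/quotW: v => s; rewrite !scaleE -pi_cat; apply/tens_piP.
elim: s => [|[m x] s IH] /=; first exact: TensRefl.
rewrite -[_ :: _ in X in tens_rel X _]/([:: (m, (a + b) * x)] ++ [seq (p.1, (a + b) * p.2) | p <- s]).
apply: TensTrans (TensCat (TensRefl _) IH) _; rewrite mulrDl.
apply: TensTrans (TensCat (TensDr _ _ _) (TensRefl _)) _.
rewrite -[_ ++ _]/([:: (m, a * x)] ++ ([:: (m, b * x)] ++
  ([seq (p.1, a * p.2) | p <- s] ++ [seq (p.1, b * p.2) | p <- s]))).
rewrite -[X in tens_rel _ X]/([:: (m, a * x)] ++ ([seq (p.1, a * p.2) | p <- s] ++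
  ([:: (m, b * x)] ++ [seq (p.1, b * p.2) | p <- s]))).
apply: TensCat; first exact: TensRefl.
by rewrite !catA; apply: TensCat; [apply: TensC|apply: TensRefl].
Qed.
HB.instance Definition _ := GRing.Zmodule_isLmodule.Build S basechange
  scaleA scale1 scaleDr scaleDl.

Lemma scale_pi a s : a *: (\pi_basechange s) = \pi_basechange [seq (p.1, a * p.2) | p <- s].
Proof. exact: scaleE. Qed.

(* f (x) g, meaningful for f and g as in basechange_mapE below *)
Definition basechange_map (f : M -> M) (g : S -> S) (x : basechange) : basechange :=
  \pi_basechange [seq (f p.1, g p.2) | p <- repr x].

Lemma basechange_mapE (phi : {rmorphism R -> R}) (f : M -> M) (g : S -> S) :
  zmod_morphism f -> zmod_morphism g ->
  (forall a m, f (a *: m) = phi a *: f m) ->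
  (forall a x, g (iota a * x) = iota (phi a) * g x) ->
  forall s, basechange_map f g (\pi_basechange s) = \pi_basechange [seq (f p.1, g p.2) | p <- s].
Proof.
move=> fB gB fZ gZ s; apply/tens_piP.
by apply: (tens_rel_map (phi := phi)) => //; apply: tens_reprK.
Qed.
End BaseChange.

(* The row vectors over R{X} as an R[t]-module: (c t^i) . m = c m T^i. *)
Section RowModule.
Variables (R : comNzRingType) (phi : {rmorphism R -> R}) (d : nat).
Variable T : 'M[skewpoly phi]_d.

Definition rowmod (T : 'M[skewpoly phi]_d) : Type := 'rV[skewpoly phi]_d.
HB.instance Definition _ (U : 'M[skewpoly phi]_d) :=
  GRing.Zmodule.copy (rowmod U) 'rV[skewpoly phi]_d.

Definition rowscale (f : {poly R}) (m : rowmod T) : rowmod T :=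
  \sum_(i < size f) skewC phi f`_i *: (m *m T ^+ i : 'rV_d).

Lemma rowscale_big n (f : {poly R}) (m : rowmod T) : (size f <= n)%N ->
  rowscale f m = \sum_(i < n) skewC phi f`_i *: (m *m T ^+ i : 'rV_d).
Proof.
move=> fn; rewrite /rowscale (big_ord_widen _ (fun i => skewC phi f`_i *: (m *m T ^+ i : 'rV_d)) fn).
rewrite big_mkcond /=; apply: eq_bigr => i _; case: ltnP => // fi.
by rewrite nth_default // rmorph0 scale0r.
Qed.

Let scaleDl (m : rowmod T) : {morph rowscale^~ m : f g / f + g}.
Proof.
move=> f g; pose n := maxn (size f) (size g).
rewrite !(@rowscale_big n) ?leq_maxl ?leq_maxr ?size_polyD //.
by rewrite -big_split; apply: eq_bigr => i _; rewrite coefD rmorphD scalerDl.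
Qed.
Let scaleDr : right_distributive rowscale +%R.
Proof.
move=> f m m'; rewrite /rowscale -big_split; apply: eq_bigr => i _.
by rewrite mulmxDl scalerDr.
Qed.
Let scaleXn c n (m : rowmod T) : rowscale (c *: 'X^n) m = skewC phi c *: (m *m T ^+ n : 'rV_d).
Proof.
rewrite (@rowscale_big n.+1); last first.
  by rewrite (leq_trans (size_scale_leq _ _)) // size_polyXn.
rewrite big_ord_recr /= big1 ?add0r => [|i _]; rewrite coefZ coefXn.
  by rewrite eqxx mulr1.
by rewrite ltn_eqF // mulr0 rmorph0 scale0r.
Qed.
Let scale1 : left_id 1 rowscale.
Proof.
by move=> m; rewrite -[1]scale1r -(expr0 'X) scaleXn rmorph1 scale1r expr0 mulmx1.
Qed.
Let scale_suml I (r : seq I) (F : I -> {poly R}) (m : rowmod T) :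
  rowscale (\sum_(i <- r) F i) m = \sum_(i <- r) rowscale (F i) m.
Proof.
by apply: (big_morph (rowscale^~ m) (scaleDl m)); rewrite /rowscale size_poly0 big_ord0.
Qed.
Let scale_sumr I (r : seq I) f (F : I -> rowmod T) :
  rowscale f (\sum_(i <- r) F i) = \sum_(i <- r) rowscale f (F i).
Proof.
apply: (big_morph (rowscale f) (scaleDr f)); rewrite /rowscale big1 // => i _.
by rewrite mul0mx scaler0.
Qed.
Let scaleA f g (m : rowmod T) : rowscale f (rowscale g m) = rowscale (f * g) m.
Proof.
rewrite -[f]coefK -[g]coefK !poly_def mulr_suml !scale_suml.
apply: eq_bigr => i _; rewrite scale_sumr mulr_sumr scale_suml.
apply: eq_bigr => j _; rewrite -scalerAl -scalerAr scalerA -exprD !scaleXn.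
by rewrite -scalemxAl scalerA -rmorphM -mulmxA mulmxE -exprD addnC.
Qed.
HB.instance Definition _ := GRing.Zmodule_isLmodule.Build {poly R} (rowmod T)
  scaleA scale1 scaleDr scaleDl.

Lemma rowscaleXnE c n (m : rowmod T) :
  (c *: 'X^n) *: m = skewC phi c *: (m *m T ^+ n : 'rV_d).
Proof. exact: scaleXn. Qed.

Definition rowtau (m : rowmod T) : rowmod T := skewX phi *: (m : 'rV_d).
End RowModule.

(* Here F = F_q, A = F_q[t] = {poly F}, and gamma : A -> K makes K an A-field,
   so that theta = gamma 'X. *)
Section Motives.
Variables (F : finFieldType) (K : fieldType) (gamma : {rmorphism {poly F} -> K}).

Definition frobq (g : {rmorphism {poly F} -> K}) (x : K) : K := x ^+ #|F|.

Arguments frobq : simpl never.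

Lemma card_pnat : [pchar K].-nat #|F|.
Proof.
have [p pr_p pF] := finPcharP F.
have pK : p \in [pchar K] by apply: (rmorph_pchar (gamma \o polyC)).
rewrite (eq_pnat _ (pcharf_eq pK)).
have := abelem_pgroup (fin_ring_pchar_abelem pF).
by rewrite /pgroup cardsT.
Qed.
Lemma frobq_is_additive : zmod_morphism (frobq gamma).
Proof.
move=> x y; have h := exprDn_pchar (x - y) y card_pnat.
by rewrite subrK in h; rewrite /frobq h addrK.
Qed.
Lemma frobq_is_monoid : monoid_morphism (frobq gamma).
Proof. by split=> [|x y]; rewrite /frobq ?expr1n ?exprMn. Qed.
HB.instance Definition _ := GRing.isZmodMorphism.Build K K (frobq gamma) frobq_is_additive.
HB.instance Definition _ := GRing.isMonoidMorphism.Build K K (frobq gamma) frobq_is_monoid.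

Definition perfect_field (L : fieldType) : Prop :=
  forall p, p \in [pchar L] -> forall x : L, exists y : L, y ^+ p = x.

Lemma frobq_surj : perfect_field K -> forall x, exists y, frobq gamma y == x.
Proof.
move=> hK x; have := card_pnat; have [p pr_p pF] := finPcharP F.
have pK : p \in [pchar K] by apply: (rmorph_pchar (gamma \o polyC)).
rewrite (eq_pnat _ (pcharf_eq pK)) => /p_natP [k]; rewrite /frobq => ->.
elim: k x => [|k IH] x; first by exists x; rewrite expr1.
have [y yx] := hK p pK x; have [z /eqP zy] := IH y.
by exists z; rewrite expnSr exprM zy yx.
Qed.

Definition frobq_root (hK : perfect_field K) (x : K) : K :=
  xchoose (frobq_surj hK x).

Section Root.
Variable hK : perfect_field K.
Lemma frobq_rootK : cancel (frobq_root hK) (frobq gamma).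
Proof. by move=> x; apply/eqP; apply: (xchooseP (frobq_surj hK x)). Qed.
Lemma frobqK : cancel (frobq gamma) (frobq_root hK).
Proof. by move=> x; apply: (fmorph_inj (frobq gamma)); rewrite /= frobq_rootK. Qed.
Lemma frobq_root_is_additive : zmod_morphism (frobq_root hK).
Proof.
by move=> x y; apply: (fmorph_inj (frobq gamma)); rewrite rmorphB /= !frobq_rootK.
Qed.
Lemma frobq_root_is_monoid : monoid_morphism (frobq_root hK).
Proof.
split=> [|x y]; apply: (fmorph_inj (frobq gamma)).
  by rewrite /= frobq_rootK rmorph1.
by rewrite rmorphM /= !frobq_rootK.
Qed.
HB.instance Definition _ :=
  GRing.isZmodMorphism.Build K K (frobq_root hK) frobq_root_is_additive.
HB.instance Definition _ :=
  GRing.isMonoidMorphism.Build K K (frobq_root hK) frobq_root_is_monoid.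
End Root.
End Motives.

(* K{tau} *)
Notation Ktau gamma := (skewpoly (frobq gamma)).

Record tmodule (F : finFieldType) (K : fieldType)
    (gamma : {rmorphism {poly F} -> K}) (d : nat) := TModule {
  tmod_hom :> {rmorphism {poly F} -> 'M[Ktau gamma]_d};
  tmod_linear : forall c : F,
    tmod_hom c%:P = (skewC (frobq gamma) (gamma c%:P))%:M;
  tmod_constant : exists2 N : 'M[K]_d, exists k, N ^+ k = 0 &
    \matrix_(i, j) skewcoef (tmod_hom 'X i j) 0 = (gamma 'X)%:M + N }.

Section TModules.
Variables (F : finFieldType) (K : fieldType) (gamma : {rmorphism {poly F} -> K}).

(* The constant term of psi_t is automatically theta: a nilpotent 1 x 1 matrix
   over K is 0. skewsize is the degree in tau plus one. *)
Record drinfeld := Drinfeld {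
  drinfeld_tmod :> tmodule gamma 1;
  drinfeld_pos : (1 < skewsize (drinfeld_tmod 'X ord0 ord0))%N }.
Definition rk (psi : drinfeld) : nat := (skewsize (psi 'X ord0 ord0)).-1.

(* Rows and columns are labelled n, ..., 1 in this order, so that position a
   carries the label n - a = (rev_ord a) + 1; psi i and delta i j stand for
   psi_{i+1} and delta_{(i+1) x (j+1)}. Only the delta i j with i < j matter. *)
Definition triangular_mx n (psi : 'I_n -> drinfeld) (delta : 'I_n -> 'I_n -> Ktau gamma) :
    'M[Ktau gamma]_n :=
  \matrix_(a, b) let i := rev_ord a in let j := rev_ord b in
    if i == j then psi i 'X ord0 ord0 else if (i < j)%N then delta i j else 0.

Definition is_triangular n (psi : 'I_n -> drinfeld) (delta : 'I_n -> 'I_n -> Ktau gamma)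
  (Upsilon : tmodule gamma n) : Prop := Upsilon 'X = triangular_mx psi delta.

Variable d : nat.
Implicit Types Phi : tmodule gamma d.

Definition motive Phi := rowmod (Phi 'X).
Definition tmod_abelian Phi : Prop :=
  free_module (motive Phi) /\ fin_generated (motive Phi).

(* sum_i a_i tau^i |-> sum_i sigma^i a_i, with values in K{sigma} *)
Definition star (hK : perfect_field K) (p : Ktau gamma) : skewpoly (frobq_root gamma hK) :=
  \sum_(i < skewsize p) skewX _ ^+ i * skewC _ (skewcoef p i).
(* K{sigma}^d is written as row vectors: t n = Phi_t n in K{tau}^d becomes
   n^* |-> n^* Phi_t^* under the anti-isomorphism star, extended to matrices by
   transposition. *)
Definition comotive (hK : perfect_field K) Phi :=
  rowmod (map_mx (star hK) (Phi 'X))^T.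
Definition tmod_finite (hK : perfect_field K) Phi : Prop :=
  free_module (comotive hK Phi) /\ fin_generated (comotive hK Phi).

Definition localmotive Phi := basechange (@lpoly K) (motive Phi).
Definition localtau Phi : localmotive Phi -> localmotive Phi :=
  basechange_map (@rowtau _ _ _ (Phi 'X)) (lmap (frobq gamma)).

Lemma rowtau_additive Phi : zmod_morphism (@rowtau _ _ _ (Phi 'X)).
Proof. by move=> x y; rewrite /rowtau scalerBr. Qed.

Lemma rowtau_semilinear Phi (a : {poly K}) (m : motive Phi) :
  rowtau (a *: m) = map_poly (frobq gamma) a *: (rowtau m : motive Phi).
Proof.
rewrite [in LHS]/GRing.scale /= /rowscale.
rewrite [RHS](rowscale_big _ (size_poly _ _)) /rowtau scaler_sumr.
apply: eq_bigr => i _; rewrite coef_map scalerA skewXC -scalerA.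
by rewrite -scalemxAl.
Qed.

Lemma localtauE Phi s : @localtau Phi (\pi s) =
  \pi [seq (rowtau p.1, lmap (frobq gamma) p.2) | p <- s].
Proof.
apply: (basechange_mapE (phi := map_poly (frobq gamma))).
- exact: rowtau_additive.
- exact: rmorphB.
- exact: rowtau_semilinear.
- by move=> a x; rewrite rmorphM /= lmap_poly.
Qed.

Lemma localtau_tensor Phi (m : motive Phi) (x : laurent K) :
  localtau (tensor (@lpoly K) m x) = tensor _ (rowtau m) (lmap (frobq gamma) x).
Proof. by rewrite /tensor localtauE. Qed.

Lemma localtauD Phi (x y : localmotive Phi) :
  localtau (x + y) = localtau x + localtau y.
Proof.
elim/quotW: x => s; elim/quotW: y => s'.
by rewrite -pi_cat !localtauE map_cat pi_cat.
Qed.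

Lemma localtauZ Phi c (x : localmotive Phi) :
  localtau (c *: x) = lmap (frobq gamma) c *: localtau x.
Proof.
elim/quotW: x => s; rewrite scale_pi !localtauE scale_pi -!map_comp.
by congr \pi_(_); apply: eq_map => p /=; rewrite rmorphM.
Qed.

(* tau^v H stands for the K[[1/t]]-submodule generated by the image of H under
   tau^v. If K is perfect this is the image itself (localtau_iter_perfect); if
   not, the image is only a module over K^(q^v), so that the plain equality of
   sets would fail already for Drinfeld modules. *)
Definition tmod_pure Phi : Prop :=
  tmod_abelian Phi /\
  exists H : set (localmotive Phi),
    [/\ submodule_over (@lint K) H, fin_generated_over (@lint K) H, generating H
      & exists u v : nat, [/\ (0 < u)%N, (0 < v)%N &
        [set lpoly 'X ^+ u *: h | h in H] =
        lincomb (@lint K) (iter v (@localtau Phi) @` H)]].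

Lemma localtau_iter_perfect (hK : perfect_field K) Phi (H : set (localmotive Phi)) v :
  submodule_over (@lint K) H ->
  lincomb (@lint K) (iter v (@localtau Phi) @` H) = iter v (@localtau Phi) @` H.
Proof.
case=> H0 HD HZ; apply/seteqP; split=> x; last first.
  move=> Hx; exists [:: x], (fun=> 1); split; last by rewrite big_seq1 scale1r.
  move=> y; rewrite inE => /eqP ->; split=> //.
  by move=> i i0 /=; rewrite gt_eqF.
have itD y z : iter v (@localtau Phi) (y + z) =
    iter v (@localtau Phi) y + iter v (@localtau Phi) z.
  by elim: v => //= k ->; rewrite localtauD.
have itZ c y : lint c -> exists2 c', lint c' &
    c *: iter v (@localtau Phi) y = iter v (@localtau Phi) (c' *: y).
  elim: v c {itD} => [|k IH] c lc; first by exists c.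
  pose c1 := lmap (frobq_root gamma hK) c.
  have lc1 : lint c1 by move=> i /lc /= ->; rewrite rmorph0.
  have -> : c = lmap (frobq gamma) c1.
    by apply: laurentP => i /=; rewrite frobq_rootK.
  by have [c' lc' e] := IH _ lc1; exists c' => //=; rewrite -localtauZ e.
have it0 : iter v (@localtau Phi) 0 = 0.
  by have := itD 0 0; rewrite addr0 => /eqP; rewrite -subr_eq subrr eq_sym => /eqP.
case=> s [c [sP ->]]; rewrite big_seq.
elim/big_ind: _ => [|_ _ [y Hy <-] [z Hz <-]|y /sP [[z Hz <-] lc]].
- by exists 0.
- by exists (y + z); [apply: HD|].
- by have [c' lc' ->] := itZ _ z lc; exists (c' *: z) => //; apply: HZ.
Qed.
End TModules.

(* Main.v *)
Require Import Defs.
From mathcomp Require Import all_boot all_order all_algebra all_field.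
From mathcomp Require Import boolp classical_sets.
From mathcomp Require Import generic_quotient zify ring.

(* Let tau^m e_a (resp. sigma^m e_a) be the monomials of the motive (resp. of the
   comotive). Multiplication by t maps tau^m e_a to a nonzero multiple of
   tau^(m + r_a) e_a, plus lower powers of tau times e_a, plus terms in e_b with
   b further along the triangular order. Lexicographic induction thus shows that
   the tau^j e_a, j < r_a, form a K[t]-basis; independence holds because the
   numbers r_a i + j, j < r_a, are distinct.

   If all r_a equal r, choose shifts s_a increasing so fast that
   the off-diagonal entries do not raise the weight (power of tau) - s_a by more
   than r. The K[[1/t]]-span H of the tau^j e_a with j < s_a + r satisfies
   t H = span of the tau^j e_a with j < s_a + 2 r = tau^r H. The low powers
   tau^j e_a, j < r, lie in tau^r H because the constant term of the diagonal
   entry only contributes the unit 1 - c / t.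

   Conversely let t^u H = tau^v H. As tau^(v m) e_k lies in t^(u m + O(1)) H and its
   k-coordinates have t-degree about v m / r_k, we get v <= u r_k. Expressing
   t^(u m) e_k through the tau^(v m + j) e_i with coefficients of bounded degree
   and eliminating the i below k, we get u r_k <= v. Hence r_k = v / u for all k. *)

Set Implicit Arguments.
Unset Strict Implicit.
Unset Printing Implicit Defensive.
Import Order.TTheory GRing.Theory Num.Theory.
Local Open Scope ring_scope.

(** * Submodules and linear combinations over a subset of the scalars *)

Section Submodule.
Variables (R : nzRingType) (V : lmodType R) (C : set R) (H : set V).
Hypothesis sH : submodule_over C H.

Lemma submodule_over0 : H 0. Proof. by case: sH. Qed.
Lemma submodule_overD x y : H x -> H y -> H (x + y).
Proof. by case: sH => _ + _; apply. Qed.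
Lemma submodule_overZ c x : C c -> H x -> H (c *: x).
Proof. by case: sH => _ _; apply. Qed.
End Submodule.

Section LinComb.
Variables (R : nzRingType) (V : lmodType R) (C : set R).
Hypotheses (C0 : C 0) (C1 : C 1) (CD : forall a b, C a -> C b -> C (a + b))
  (CM : forall a b, C a -> C b -> C (a * b)).
Implicit Types (B H : set V).

Lemma submodule_over_sum H (I : eqType) (s : seq I) (P : pred I) (F : I -> V) :
  submodule_over C H -> (forall i, i \in s -> P i -> H (F i)) ->
  H (\sum_(i <- s | P i) F i).
Proof.
case=> H0 HD HZ HF; rewrite big_seq_cond.
by apply: (big_ind H) => // i /andP[]; apply: HF.
Qed.

(** The standard tool below: an inclusion is tested on generators, often with [H] a property such as
    having bounded coordinates. *)
Lemma lincomb_min B H : submodule_over C H -> (forall x, B x -> H x) ->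
  forall x, lincomb C B x -> H x.
Proof.
move=> sH BH x [s [c [sP ->]]]; apply: submodule_over_sum => // y /sP[By Cy] _.
by case: sH => _ _; apply=> //; apply: BH.
Qed.

Lemma mem_lincomb B x : B x -> lincomb C B x.
Proof.
move=> Bx; exists [:: x], (fun=> 1); rewrite big_seq1 scale1r; split=> // y.
by rewrite inE => /eqP ->.
Qed.

Lemma lincomb_submodule B : submodule_over C (lincomb C B).
Proof.
split.
- by exists [::], (fun=> 0); rewrite big_nil.
- move=> _ _ [s [c [sP ->]]] [s' [c' [sP' ->]]].
  (* The two lists may overlap or repeat entries, while a combination has a single coefficient
     function; both sums are therefore rewritten over one duplicate-free list, with multiplicities
     moved into the coefficients. *)
  have mulrn_count (z : seq V) (g : V -> R) (w : seq V) : uniq w -> {subset z <= w} ->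
      \sum_(x <- z) g x *: x = \sum_(x <- w) (g x *+ count_mem x z) *: x.
    move=> uw; elim: z => [|y z IH] zw.
      by rewrite big_nil big1 // => x _; rewrite mulr0n scale0r.
    rewrite big_cons IH => [|x xz]; last by apply: zw; rewrite inE xz orbT.
    under [RHS]eq_bigr => x _ do rewrite /= mulrnDr scalerDl.
    rewrite big_split /=; congr (_ + _).
    rewrite (bigD1_seq y) //=; last by apply: zw; rewrite mem_head.
    by rewrite eqxx big1 ?addr0 // => x /negPf; rewrite eq_sym => ->; rewrite mulr0n scale0r.
  pose w := undup (s ++ s').
  have uw : uniq w by apply: undup_uniq.
  have Cn a k : C a -> C (a *+ k) by move=> Ca; elim: k => // k IH; rewrite mulrS; apply: CD.
  exists w, (fun x => c x *+ count_mem x s + c' x *+ count_mem x s'); split.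
    move=> x; rewrite mem_undup mem_cat => xs; split.
      by case/orP: xs => [/sP[]|/sP'[]].
    have C_count (z : seq V) (g : V -> R) :
        (forall y, y \in z -> B y /\ C (g y)) -> C (g x *+ count_mem x z).
      move=> zP; have [/zP[_ /Cn]//|/count_memPn ->] := boolP (x \in z).
      by rewrite mulr0n.
    by apply: CD; apply: C_count.
  under [RHS]eq_bigr => x _ do rewrite scalerDl.
  rewrite big_split /=; congr (_ + _); apply: mulrn_count => // x;
    by rewrite mem_undup mem_cat => ->; rewrite ?orbT.
- move=> a _ Ca [s [c [sP ->]]]; exists s, (fun x => a * c x).
  split=> [x /sP[Bx Cx]|]; first by split=> //; apply: CM.
  by rewrite scaler_sumr; apply: eq_bigr => x _; rewrite scalerA.
Qed.

Lemma lincomb_sub B B' : (forall x, B x -> lincomb C B' x) ->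
  forall x, lincomb C B x -> lincomb C B' x.
Proof. by apply: lincomb_min; apply: lincomb_submodule. Qed.
End LinComb.

Lemma lincombT_submodule (R : nzRingType) (V : lmodType R) (B : set V) :
  submodule_over setT (lincomb setT B).
Proof. exact: lincomb_submodule. Qed.

Lemma lincombT_sub (R : nzRingType) (V : lmodType R) (B B' : set V) :
  (forall x, B x -> lincomb setT B' x) -> forall x, lincomb setT B x -> lincomb setT B' x.
Proof. exact: lincomb_sub. Qed.

(** * Skew polynomials over a field: coefficients and degree *)

Section SkewTheory.
Variables (K : fieldType) (phi : {rmorphism K -> K}).
Implicit Types p q : skewpoly phi.

Lemma skewcoef0 i : skewcoef (0 : skewpoly phi) i = 0.
Proof. exact: coef0. Qed.

Lemma skewcoef_sum I (s : seq I) (P : pred I) (G : I -> skewpoly phi) i :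
  skewcoef (\sum_(j <- s | P j) G j) i = \sum_(j <- s | P j) skewcoef (G j) i.
Proof.
apply: (big_morph (fun p : skewpoly phi => skewcoef p i)) => [p q|].
  exact: skewcoefD.
exact: skewcoef0.
Qed.

Lemma skewcoef_default p i : (skewsize p <= i)%N -> skewcoef p i = 0.
Proof. exact: nth_default. Qed.

Lemma skewcoefCM c p i : skewcoef (skewC phi c * p) i = c * skewcoef p i.
Proof.
rewrite skewcoefM big_ord_recl /= skewcoefC eqxx subn0 big1 ?addr0 // => j _.
by rewrite skewcoefC /= mul0r.
Qed.

Lemma skewcoefXM p i :
  skewcoef (skewX phi * p) i = if i is i'.+1 then phi (skewcoef p i') else 0.
Proof.
rewrite skewcoefM big_ord_recl /= skewcoefX mul0r add0r.
case: i => [|i]; first by rewrite big_ord0.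
rewrite big_ord_recl /= skewcoefX mul1r subSS subn0 big1 ?addr0 // => j _.
by rewrite skewcoefX mul0r.
Qed.

Lemma skewcoefXnM m p i :
  skewcoef (skewX phi ^+ m * p) i =
  if (m <= i)%N then iter m phi (skewcoef p (i - m)) else 0.
Proof.
elim: m i => [|m IH] i; first by rewrite mul1r subn0.
rewrite exprS -mulrA skewcoefXM; case: i => [|i] //.
by rewrite IH ltnS subSS; case: ifP; rewrite // rmorph0.
Qed.

Lemma skewcoefXn m i : skewcoef (skewX phi ^+ m) i = (i == m)%:R.
Proof.
rewrite -[_ ^+ m]mulr1 skewcoefXnM -(rmorph1 (skewC phi)) skewcoefC subn_eq0.
by have [le_mi|lt_im|->] := ltngtP m i; rewrite ?leqnn ?iter_phi1 // iter_phi0.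
Qed.

Lemma skewpoly_def E p : (skewsize p <= E)%N ->
  p = \sum_(i < E) skewC phi (skewcoef p i) * skewX phi ^+ i.
Proof.
move=> pE; apply: skewcoefP => j; rewrite skewcoef_sum.
under eq_bigr => i _ do rewrite skewcoefCM skewcoefXn.
have [jE|Ej] := ltnP j E; last first.
  rewrite skewcoef_default ?(leq_trans pE) // big1 // => i _.
  by rewrite gtn_eqF ?mulr0 //; apply: leq_trans Ej.
rewrite (bigD1 (Ordinal jE)) //= eqxx mulr1 big1 ?addr0 // => i /negPf ne.
by rewrite eq_sym [_ == _]ne mulr0.
Qed.

Lemma skewXnC m c : skewX phi ^+ m * skewC phi c = skewC phi (iter m phi c) * skewX phi ^+ m.
Proof.
elim: m => [|m IH]; first by rewrite mulr1 mul1r.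
by rewrite exprS -mulrA IH mulrA skewXC -mulrA -exprS.
Qed.

Lemma iter_phi_eq0 m c : (iter m phi c == 0) = (c == 0).
Proof. by elim: m => //= m IH; rewrite fmorph_eq0. Qed.

Definition skewdegree p (d : nat) := skewcoef p d != 0 /\ forall i, (d < i)%N -> skewcoef p i = 0.

(** The coefficient of X^(d + e) is p_d phi^d(q_e), nonzero because an endomorphism of a field is
    injective. *)
Lemma skewdegreeM p q d e : skewdegree p d -> skewdegree q e -> skewdegree (p * q) (d + e).
Proof.
move=> [pd pz] [qe qz]; split; last first.
  move=> i di; rewrite skewcoefM big1 // => j _.
  have [dj|jd] := ltnP d j; first by rewrite pz // mul0r.
  by rewrite qz ?iter_phi0 ?mulr0 //; have := ltn_ord j; lia.
rewrite skewcoefM (bigD1 (Ordinal (leq_addr e d : (d < (d + e).+1)%N))) //= big1 ?addr0.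
  by rewrite addKn mulf_neq0 // iter_phi_eq0.
move=> j; rewrite -val_eqE /= => jd.
have [dj|jd'] := ltnP d j; first by rewrite pz // mul0r.
by rewrite qz ?iter_phi0 ?mulr0 //; lia.
Qed.

Lemma skewdegree1 : skewdegree 1 0.
Proof.
rewrite -(rmorph1 (skewC phi)); split=> [|[]// i _]; rewrite skewcoefC //=.
exact: oner_neq0.
Qed.

Lemma skewdegreeX p d k : skewdegree p d -> skewdegree (p ^+ k) (d * k).
Proof.
move=> pd; elim: k => [|k IH]; first by rewrite muln0; apply: skewdegree1.
by rewrite exprS mulnS; apply: skewdegreeM.
Qed.

Lemma skewdegreeXn m : skewdegree (skewX phi ^+ m) m.
Proof.
split=> [|i mi]; rewrite skewcoefXn ?eqxx ?oner_neq0 //.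
by rewrite gtn_eqF.
Qed.

Lemma skewsize_degree p : (0 < skewsize p)%N -> skewdegree p (skewsize p).-1.
Proof.
move=> p0; split=> [|i]; last by rewrite prednK //; apply: skewcoef_default.
by rewrite /skewcoef /skewsize -/(lead_coef _) lead_coef_eq0 -size_poly_gt0.
Qed.

(** Distinct degrees force independence: the last term is alone in its degree, so its coefficient
    vanishes and the sum shortens. *)
Lemma skewdegree_free (g : nat -> skewpoly phi) (c : nat -> K) L :
  (forall l, skewdegree (g l) l) -> \sum_(l < L) skewC phi (c l) * g l = 0 ->
  forall l, (l < L)%N -> c l = 0.
Proof.
move=> gP; elim: L => // L IH; rewrite big_ord_recr /= => s0.
have cL : c L = 0.
  have := congr1 (fun p : skewpoly phi => skewcoef p L) s0.
  rewrite skewcoefD skewcoef_sum skewcoefCM skewcoef0 big1 ?add0r => [|i _].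
    by move/eqP; rewrite mulf_eq0 => /orP[/eqP //|]; rewrite (negPf (gP L).1).
  by rewrite skewcoefCM (gP i).2 ?mulr0.
move: s0; rewrite cL rmorph0 mul0r addr0 => /IH{}IH l.
by rewrite ltnS leq_eqVlt => /predU1P[->|/IH].
Qed.
End SkewTheory.

(** * The K[t]-module of row vectors defined by a triangular matrix, and its basis *)

Section Triangular.
Variables (K : fieldType) (phi : {rmorphism K -> K}) (n : nat).
Variables (T : 'M[skewpoly phi]_n) (pos : 'I_n -> nat).

(* pos need not be injective: entries between distinct indices of equal position vanish. *)
Definition triangular_wrt :=
  (forall a b, T a b != 0 -> a = b \/ (pos a < pos b)%N) /\
  (forall a, (1 < skewsize (T a a))%N).
Hypothesis Ttri : triangular_wrt.

Definition diagrk a := (skewsize (T a a)).-1.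
Definition maxsize := \max_a \max_b skewsize (T a b).
Definition taubasis a m : rowmod T := skewX phi ^+ m *: (delta_mx 0 a : 'rV_n).
(** The coefficient of tau^(m + i) e_b in t tau^m e_a; the twist comes from moving tau^m past a
    scalar. *)
Definition taucoef a b m i := iter m phi (skewcoef (T a b) i).

Lemma leq_maxsize a b : (skewsize (T a b) <= maxsize)%N.
Proof.
apply: leq_trans (leq_bigmax (F := fun a => \max_b skewsize (T a b)) a).
exact: (leq_bigmax (F := fun b => skewsize (T a b)) b).
Qed.

Lemma diagrk_gt0 a : (0 < diagrk a)%N.
Proof. by have := Ttri.2 a; rewrite /diagrk; case: skewsize => [|[]]. Qed.

Lemma skewdegree_diag a : skewdegree (T a a) (diagrk a).
Proof. by apply: skewsize_degree; apply: ltnW; apply: Ttri.2. Qed.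

Lemma taucoef_diag_neq0 a m : taucoef a a m (diagrk a) != 0.
Proof. by rewrite /taucoef iter_phi_eq0; case: (skewdegree_diag a). Qed.

Lemma taucoef_diag0 a m i : (diagrk a < i)%N -> taucoef a a m i = 0.
Proof. by move=> ai; rewrite /taucoef (skewdegree_diag a).2 ?iter_phi0. Qed.

Lemma taucoef_eq0 a b m i : a != b -> (pos b <= pos a)%N -> taucoef a b m i = 0.
Proof.
move=> ab ba; rewrite /taucoef; have [->|/Ttri.1] := eqVneq (T a b) 0.
  by rewrite skewcoef0 iter_phi0.
by case=> [/eqP|]; [rewrite (negPf ab)|rewrite ltnNge ba].
Qed.

Lemma rowscaleC c (m : rowmod T) : c%:P *: m = skewC phi c *: (m : 'rV_n).
Proof.
have := rowscaleXnE c 0 m; rewrite expr0 mulmx1 => <-.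
by rewrite -mul_polyC mulr1.
Qed.

Lemma rowscaleX (m : rowmod T) : 'X *: m = (m : 'rV_n) *m T.
Proof.
have := rowscaleXnE 1 1 m.
by rewrite scale1r expr1 rmorph1 scale1r expr1.
Qed.

Lemma rowtau_taubasis a m : rowtau (taubasis a m) = taubasis a m.+1.
Proof. by rewrite /rowtau /taubasis scalerA -exprS. Qed.

Lemma taubasisX a m : 'X *: taubasis a m =
  \sum_b \sum_(i < maxsize) (taucoef a b m i)%:P *: taubasis b (m + i).
Proof.
rewrite rowscaleX /taubasis -scalemxAl -rowE [row a T]row_sum_delta scaler_sumr.
apply: eq_bigr => b _; rewrite mxE scalerA.
rewrite {1}(skewpoly_def (leq_maxsize a b)) mulr_sumr scaler_suml.
apply: eq_bigr => i _; rewrite rowscaleC mulrA skewXnC -mulrA -exprD.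
by rewrite -scalerA.
Qed.

Lemma taubasis_span (m : rowmod T) : m =
  \sum_a \sum_(i < skewsize ((m : 'rV_n) 0 a))
     (skewcoef ((m : 'rV_n) 0 a) i)%:P *: taubasis a i.
Proof.
rewrite [LHS]row_sum_delta; apply: eq_bigr => a _.
rewrite {1}(skewpoly_def (leqnn (skewsize ((m : 'rV_n) 0 a)))) scaler_suml.
by apply: eq_bigr => i _; rewrite rowscaleC /taubasis scalerA.
Qed.

(** Lexicographic induction: later positions first, then lower powers. It is well-founded because
    positions are bounded by some N and N - [pos a] decreases. *)
Lemma triangular_ind (P : 'I_n -> nat -> Prop) :
  (forall a m, (forall b m', (pos a < pos b)%N -> P b m') ->
     (forall m', (m' < m)%N -> P a m') -> P a m) ->
  forall a m, P a m.
Proof.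
move=> IP; pose N := \max_a pos a.
have posN a : (pos a <= N)%N by apply: leq_bigmax.
suff PN k a m : (N - pos a < k)%N -> P a m by move=> a m; apply: (PN _ a m (leqnn _)).
elim: k a m => // k IHk a m; rewrite ltnS => ak.
elim/ltn_ind: m => m IHm; apply: IP => // b m' ab.
by apply: IHk; have := posN b; lia.
Qed.

(** Isolates the highest power of tau at the index a; every monomial on the right has a lower power
    there or a later index, so it is accessible to [triangular_ind]. *)
Lemma taubasis_lead a m : (taucoef a a m (diagrk a))%:P *: taubasis a (m + diagrk a) =
  'X *: taubasis a m - \sum_(i < diagrk a) (taucoef a a m i)%:P *: taubasis a (m + i)
  - \sum_(b | (pos a < pos b)%N) \sum_(i < maxsize) (taucoef a b m i)%:P *: taubasis b (m + i).
Proof.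
rewrite taubasisX (bigD1 a) //=.
have ra : (diagrk a < maxsize)%N.
  by rewrite /diagrk prednK ?leq_maxsize //; apply: ltnW; apply: Ttri.2.
have -> : \sum_(b | b != a) \sum_(i < maxsize) (taucoef a b m i)%:P *: taubasis b (m + i) =
    \sum_(b | (pos a < pos b)%N) \sum_(i < maxsize) (taucoef a b m i)%:P *: taubasis b (m + i).
  rewrite big_mkcond [RHS]big_mkcond; apply: eq_bigr => b _.
  have [->|ba] := eqVneq b a; first by rewrite ltnn.
  case: ltnP => //= ab; rewrite big1 // => i _.
  by rewrite taucoef_eq0 ?polyC0 ?scale0r // eq_sym.
rewrite addrAC addrK.
have -> : \sum_(i < maxsize) (taucoef a a m i)%:P *: taubasis a (m + i) =
    \sum_(i < (diagrk a).+1) (taucoef a a m i)%:P *: taubasis a (m + i).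
  rewrite (big_ord_widen _ (fun i => (taucoef a a m i)%:P *: taubasis a (m + i)) ra).
  rewrite [RHS]big_mkcond; apply: eq_bigr => i _; case: ltnP => // ai.
  by rewrite taucoef_diag0 ?polyC0 ?scale0r.
by rewrite big_ord_recr /= addrAC subrr add0r.
Qed.

Definition basisset (k : nat) : set (rowmod T) :=
  [set m | exists a j, [/\ (k <= pos a)%N, (j < diagrk a)%N & m = taubasis a j]].

(** The leading coefficient in [taubasis_lead] is a nonzero constant, so a monomial with
    [m >= diagrk a] is a combination of smaller ones. *)
Lemma taubasis_generated a m : lincomb setT (basisset (pos a)) (taubasis a m).
Proof.
move: a m; apply: triangular_ind => a m IHb IHm.
have [ma|am] := ltnP m (diagrk a).
  by apply: mem_lincomb => //; exists a, m.
rewrite -(subnK am); set k := (m - _)%N.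
have lt_km : (k < m)%N by rewrite /k; have := diagrk_gt0 a; lia.
have [H0 HD HZ] := @lincombT_submodule _ _ (basisset (pos a)).
have hsub x y : lincomb setT (basisset (pos a)) x -> lincomb setT (basisset (pos a)) y ->
    lincomb setT (basisset (pos a)) (x - y).
  by move=> hx hy; apply: HD => //; rewrite -scaleN1r; apply: HZ.
suff : lincomb setT (basisset (pos a))
    ((taucoef a a k (diagrk a))%:P *: taubasis a (k + diagrk a)).
  move/(HZ (taucoef a a k (diagrk a))^-1%:P _ I).
  by rewrite scalerA -polyCM mulVf ?taucoef_diag_neq0 // scale1r.
rewrite taubasis_lead; apply: (hsub); first apply: (hsub).
- by apply: (HZ) => //; apply: IHm.
- apply: submodule_over_sum (lincombT_submodule _) _ => i _ _.
  by apply: (HZ) => //; apply: IHm; have := ltn_ord i; lia.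
- apply: submodule_over_sum (lincombT_submodule _) _ => b _ ab.
  apply: submodule_over_sum (lincombT_submodule _) _ => i _ _.
  apply: HZ => //.
  apply: lincombT_sub (IHb b _ ab).
  move=> x [c [j [bc jc ->]]]; apply: mem_lincomb => //; exists c, j; split=> //.
  by apply: leq_trans bc; apply: ltnW.
Qed.

Lemma basisset_generating : generating (basisset 0).
Proof.
apply/seteqP; split=> // m _; rewrite (taubasis_span m).
apply: submodule_over_sum (lincombT_submodule _) _ => a _ _.
apply: submodule_over_sum (lincombT_submodule _) _ => i _ _.
have [_ _ HZ] := @lincombT_submodule _ _ (basisset 0); apply: HZ => //.
apply: lincombT_sub (taubasis_generated a i).
move=> x [c [j [_ jc ->]]]; apply: mem_lincomb => //; by exists c, j.
Qed.

Lemma exprmx_triangular i a b : (pos a <= pos b)%N ->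
  (T ^+ i) b a = if b == a then T a a ^+ i else 0.
Proof.
elim: i b => [|i IH] b ab; first by rewrite !expr0 mxE; case: eqP.
rewrite exprS -mulmxE mxE (bigD1 b) //= big1 ?addr0 => [|c cb].
  by rewrite IH //; case: eqP => [->|_]; rewrite ?exprS ?mulr0.
have [->|/Ttri.1[/eqP|bc]] := eqVneq (T b c) 0; first by rewrite mul0r.
  by rewrite eq_sym (negPf cb).
rewrite IH; last by apply: leq_trans ab (ltnW bc).
by case: eqP => [e|_]; [move: bc; rewrite e ltnNge ab|rewrite mulr0].
Qed.

Lemma comp_scale_taubasis f a b j : (pos a <= pos b)%N ->
  ((f *: taubasis b j : rowmod T) : 'rV_n) 0 a =
  if b == a then \sum_(i < size f) skewC phi f`_i * (skewX phi ^+ j * T a a ^+ i) else 0.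
Proof.
move=> ab; rewrite [in LHS]/GRing.scale /= /rowscale summxE.
have E i : (skewC phi f`_i *: ((taubasis b j : 'rV_n) *m T ^+ i)) 0 a =
    if b == a then skewC phi f`_i * (skewX phi ^+ j * T a a ^+ i) else 0.
  rewrite mxE /taubasis -scalemxAl mxE -rowE mxE exprmx_triangular //.
  by case: eqP; rewrite ?mulr0.
rewrite (eq_bigr (fun i : 'I__ => if b == a then skewC phi f`_i * (skewX phi ^+ j * T a a ^+ i) else 0)).
  by case: eqP => // _; rewrite big1.
by move=> i _; exact: E.
Qed.

(** Used with l = i r_a + j, the degree of tau^j times the i-th power of the diagonal entry. *)
Lemma sum_mul_ord (V : nmodType) (F : nat -> V) L r :
  \sum_(l < L * r) F l = \sum_(j < r) \sum_(i < L) F (i * r + j)%N.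
Proof.
rewrite exchange_big /=; elim: L => [|L IH]; first by rewrite !big_ord0.
rewrite big_ord_recr -IH mulSnr big_split_ord /=.
by congr (_ + _).
Qed.

(** Read the relation in component a: earlier indices drop out by induction on the position, and the
    others do not reach a. What remains combines the elements tau^j T_aa^i, of pairwise distinct
    degrees i r_a + j. *)
Lemma taubasis_free (c : 'I_n -> nat -> {poly K}) :
  \sum_a \sum_(j < diagrk a) c a j *: taubasis a j = 0 ->
  forall a j, (j < diagrk a)%N -> c a j = 0.
Proof.
move=> s0 a; have [k] := ubnP (pos a); elim: k a => // k IH a; rewrite ltnS => ak.
have {}IH b j : (pos b < pos a)%N -> (j < diagrk b)%N -> c b j = 0.
  by move=> ba; apply: IH; apply: leq_trans ba ak.
have ra := diagrk_gt0 a.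
pose L := \max_(j < diagrk a) size (c a j).
have cL j : (j < diagrk a)%N -> (size (c a j) <= L)%N.
  by move=> ja; apply: (leq_bigmax (F := fun j : 'I_(diagrk a) => size (c a j)) (Ordinal ja)).
pose g l := skewX phi ^+ (l %% diagrk a) * T a a ^+ (l %/ diagrk a).
have gl l : skewdegree (g l) l.
  rewrite [X in skewdegree _ X](divn_eq l (diagrk a)) addnC mulnC.
  apply: skewdegreeM; first exact: skewdegreeXn.
  exact/skewdegreeX/skewdegree_diag.
have := congr1 (fun m : rowmod T => (m : 'rV_n) 0 a) s0.
rewrite [RHS]mxE summxE (bigD1 a) //= [X in _ + X]big1 ?addr0 => [|b ba]; last first.
  rewrite summxE big1 // => j _; have [ab|{}ba'] := leqP (pos a) (pos b).
    by rewrite comp_scale_taubasis // (negPf ba).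
  by rewrite IH // scale0r mxE.
rewrite summxE => s0a.
have : \sum_(l < L * diagrk a) skewC phi (c a (l %% diagrk a)%N)`_(l %/ diagrk a)%N * g l = 0.
  rewrite -[RHS]s0a (sum_mul_ord (fun l => skewC phi (c a (l %% diagrk a)%N)`_(l %/ diagrk a)%N * g l)).
  apply: eq_bigr => j _; rewrite comp_scale_taubasis // eqxx.
  rewrite (big_ord_widen _ (fun i => skewC phi (c a j)`_i * (skewX phi ^+ j * T a a ^+ i)) (cL j (ltn_ord j))).
  rewrite [RHS]big_mkcond; apply: eq_bigr => i _.
  rewrite /g divnMDl // modnMDl modn_small // divn_small // addn0.
  by case: ltnP => // si; rewrite nth_default // rmorph0 mul0r.
move/(skewdegree_free (c := fun l => (c a (l %% diagrk a)%N)`_(l %/ diagrk a)%N) gl) => h j ja.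
apply/polyP => i; rewrite coef0; have [iL|Li] := ltnP i L; last first.
  by rewrite nth_default // (leq_trans (cL j ja)).
have := h (i * diagrk a + j)%N; rewrite divnMDl // modnMDl modn_small // divn_small // addn0.
by apply; apply: leq_trans (leq_mul iL (leqnn _)); rewrite mulSn addnC ltn_add2r.
Qed.

Lemma taubasis_coord k m : lincomb setT (basisset k) m ->
  exists2 c : 'I_n -> nat -> {poly K},
    (forall a j, ((pos a < k) || (diagrk a <= j))%N -> c a j = 0) &
    m = \sum_a \sum_(j < diagrk a) c a j *: taubasis a j.
Proof.
move: m; apply: (lincomb_min (H := fun m : rowmod T => exists2 c : 'I_n -> nat -> {poly K},
  (forall a j, ((pos a < k) || (diagrk a <= j))%N -> c a j = 0) &
  m = \sum_a \sum_(j < diagrk a) c a j *: taubasis a j)) => [|x [a [j [ka ja ->]]]].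
  split.
  - exists (fun _ _ => 0) => //; rewrite big1 // => a _; rewrite big1 // => j _.
    by rewrite scale0r.
  - move=> _ _ [c c0 ->] [d d0 ->]; exists (fun a j => c a j + d a j).
      by move=> a j h; rewrite c0 ?d0 ?addr0.
    rewrite -big_split; apply: eq_bigr => a _; rewrite -big_split.
    by apply: eq_bigr => j _; rewrite scalerDl.
  - move=> f _ _ [c c0 ->]; exists (fun a j => f * c a j).
      by move=> a j h; rewrite c0 ?mulr0.
    rewrite scaler_sumr; apply: eq_bigr => a _; rewrite scaler_sumr.
    by apply: eq_bigr => j _; rewrite scalerA.
exists (fun b i => ((b == a) && (i == j))%:R).
  move=> b i; case: eqP => //= ->; case: eqP => //= ->.
  by rewrite ltnNge ka leqNgt ja.
rewrite (bigD1 a) //= [X in _ + X]big1 ?addr0 => [|b /negPf ->]; last first.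
  by rewrite big1 // => i _; rewrite scale0r.
rewrite (bigD1 (Ordinal ja)) //= !eqxx scale1r big1 ?addr0 // => i.
by rewrite -val_eqE /= => /negPf ->; rewrite scale0r.
Qed.

(** Choice makes the coordinates a function. Padding with zero for [diagrk a <= j] lets j range over
    the natural numbers, without a type depending on a. *)
Lemma exists_coord m : { c : 'I_n -> nat -> {poly K} |
    (forall a j, (diagrk a <= j)%N -> c a j = 0) /\
    m = \sum_a \sum_(j < diagrk a) c a j *: taubasis a j }.
Proof.
apply: cid; have [] := @taubasis_coord 0 m; first by rewrite basisset_generating.
by move=> c c0 cm; exists c; split.
Qed.

Definition coord m : 'I_n -> nat -> {poly K} := sval (exists_coord m).

Lemma coord_default m a j : (diagrk a <= j)%N -> coord m a j = 0.
Proof. by rewrite /coord; case: exists_coord => c [c0 _] /=; apply: c0. Qed.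

Lemma coordE m : m = \sum_a \sum_(j < diagrk a) coord m a j *: taubasis a j.
Proof. by rewrite /coord; case: exists_coord => c []. Qed.

Lemma coord_sum (c : 'I_n -> nat -> {poly K}) a j : (j < diagrk a)%N ->
  coord (\sum_b \sum_(i < diagrk b) c b i *: taubasis b i) a j = c a j.
Proof.
move=> ja; set y := \sum_b _.
apply/eqP; rewrite -subr_eq0; apply/eqP; apply: (taubasis_free (c := fun a j => coord y a j - c a j)) ja.
rewrite -[RHS](subrr y) {2}[y]coordE -sumrB; apply: eq_bigr => b _.
by rewrite -sumrB; apply: eq_bigr => i _; rewrite scalerBl.
Qed.

Lemma coordD m m' a j : coord (m + m') a j = coord m a j + coord m' a j.
Proof.
have [aj|ja] := leqP (diagrk a) j; first by rewrite !coord_default ?addr0.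
rewrite -(coord_sum (fun b i => coord m b i + coord m' b i) ja); congr (coord _ a j).
rewrite {1}[m]coordE {1}[m']coordE -big_split; apply: eq_bigr => b _.
by rewrite -big_split; apply: eq_bigr => i _; rewrite scalerDl.
Qed.

Lemma coordZ f m a j : coord (f *: m) a j = f * coord m a j.
Proof.
have [aj|ja] := leqP (diagrk a) j; first by rewrite !coord_default ?mulr0.
rewrite -(coord_sum (fun b i => f * coord m b i) ja); congr (coord _ a j).
rewrite {1}[m]coordE scaler_sumr; apply: eq_bigr => b _.
by rewrite scaler_sumr; apply: eq_bigr => i _; rewrite scalerA.
Qed.

Lemma coord_taubasis a b i j : (i < diagrk b)%N ->
  coord (taubasis b i) a j = ((a == b) && (j == i))%:R.
Proof.
move=> ib; have [aj|ja] := leqP (diagrk a) j.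
  by rewrite coord_default //; case: eqP => //= ab; rewrite gtn_eqF //; move: ib; rewrite -ab => /leq_trans; apply.
pose c (a : 'I_n) (j : nat) := ((a == b) && (j == i))%:R : {poly K}.
rewrite -[RHS](coord_sum c ja); congr (coord _ a j).
rewrite (bigD1 b) //= [X in _ + X]big1 ?addr0 => [|a' /negPf ab]; last first.
  by rewrite big1 // => l _; rewrite /c ab scale0r.
rewrite (bigD1 (Ordinal ib)) //= /c !eqxx scale1r big1 ?addr0 // => l.
by rewrite -val_eqE /= => /negPf ->; rewrite scale0r.
Qed.

(** Triangularity survives in coordinates: the recurrence [taubasis_lead] leads from b only to b
    itself and to later positions. *)
Lemma coord_taubasis0 a b m j : a != b -> (pos a <= pos b)%N -> coord (taubasis b m) a j = 0.
Proof.
move: b m; apply: triangular_ind => b m IHb IHm ab le_ab.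
have [mb|bm] := ltnP m (diagrk b); first by rewrite coord_taubasis // (negPf ab).
rewrite -(subnK bm); set k := (m - _)%N.
have lt_km : (k < m)%N by rewrite /k; have := diagrk_gt0 b; lia.
(* Multiplying by the nonzero leading coefficient brings the monomial into the form of
   [taubasis_lead]. *)
apply: (mulfI (x := (taucoef b b k (diagrk b))%:P)).
  by rewrite polyC_eq0 taucoef_diag_neq0.
have c0 : coord 0 a j = 0 by rewrite -[0](scale0r 0) coordZ mul0r.
have cN x : coord (- x) a j = - coord x a j by rewrite -scaleN1r coordZ mulN1r.
have csum I (s : seq I) (P : pred I) (G : I -> rowmod T) :
    coord (\sum_(i <- s | P i) G i) a j = \sum_(i <- s | P i) coord (G i) a j.
  by apply: (big_morph (fun x => coord x a j)) => // x y; rewrite coordD.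
rewrite -coordZ taubasis_lead !coordD !cN (coordZ 'X) IHm // mulr0 !csum.
rewrite big1 => [|i _]; last by rewrite coordZ IHm ?mulr0 //; have := ltn_ord i; lia.
rewrite big1 ?subr0 ?mulr0 // => c bc; rewrite csum big1 // => i _.
have ac : (pos a < pos c)%N by apply: leq_ltn_trans bc.
rewrite coordZ IHb ?mulr0 //; last exact: ltnW.
by apply: contraTneq ac => ->; rewrite ltnn.
Qed.

Lemma taubasis_inj a b i j : taubasis a i = taubasis b j -> a = b /\ i = j.
Proof.
move=> e; have := congr1 (fun m : rowmod T => skewcoef ((m : 'rV_n) 0 a) i) e.
rewrite !mxE !eqxx /= mulr1 skewcoefXn eqxx; case: eqP => [->|_].
  by rewrite mulr1 skewcoefXn; case: eqP => // _ /eqP; rewrite oner_eq0.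
by rewrite mulr0 skewcoef0 => /eqP; rewrite oner_eq0.
Qed.

Definition basisseq : seq (rowmod T) :=
  [seq taubasis a j | a <- index_enum 'I_n, j <- iota 0 (diagrk a)].

Lemma mem_basisseq x : (x \in basisseq) <-> basisset 0 x.
Proof.
split=> [/allpairsPdep[a [j [_ + ->]]]|[a [j [_ ja ->]]]].
  by rewrite mem_iota => /andP[_ ja]; exists a, j.
apply/allpairsPdep; exists a, j; split=> //; first exact: mem_index_enum.
by rewrite mem_iota.
Qed.

Lemma basisseq_uniq : uniq basisseq.
Proof.
apply: allpairs_uniq_dep; first exact: index_enum_uniq.
- by move=> a _; apply: iota_uniq.
- by move=> [a i] [b j] _ _ /= /taubasis_inj[-> ->].
Qed.

Lemma sum_basisseq (c : rowmod T -> {poly K}) : \sum_(x <- basisseq) c x *: x =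
  \sum_a \sum_(j < diagrk a) c (taubasis a j) *: taubasis a j.
Proof.
rewrite big_allpairs_dep; apply: eq_bigr => a _.
by rewrite -{1}(subn0 (diagrk a)) -/(index_iota 0 (diagrk a)) big_mkord.
Qed.

Lemma triangular_free : free_module (rowmod T).
Proof.
exists (basisset 0); split; first exact: basisset_generating.
move=> s c us sB s0 x xs; have [a [j [_ ja xE]]] := sB x xs.
(* Extends the relation by zero from [s] to the whole basis. *)
pose c' x := if x \in s then c x else 0.
have : \sum_b \sum_(i < diagrk b) c' (taubasis b i) *: taubasis b i = 0.
  rewrite -sum_basisseq -[RHS]s0.
  have -> : \sum_(y <- s) c y *: y = \sum_(y <- [seq y <- basisseq | y \in s]) c y *: y.
    apply: perm_big; apply: uniq_perm; rewrite ?filter_uniq ?basisseq_uniq // => y.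
    rewrite mem_filter; case: (boolP (y \in s)) => //= /sB h.
    by apply/esym/mem_basisseq.
  rewrite big_filter [RHS]big_mkcond; apply: eq_bigr => y _.
  by rewrite /c'; case: ifP; rewrite // scale0r.
move/(taubasis_free (c := fun b i => c' (taubasis b i))) => /(_ a j ja); rewrite -xE /c'.
by rewrite xs.
Qed.

Lemma triangular_fin_generated : fin_generated (rowmod T).
Proof.
exists basisseq; have := basisset_generating; rewrite /generating => <-; congr lincomb.
by apply/seteqP; split=> x /mem_basisseq.
Qed.
End Triangular.

(** * The adjoint matrix, which governs the comotive *)

Section Star.
Variables (F : finFieldType) (K : fieldType) (gamma : {rmorphism {poly F} -> K}).
Variable hK : perfect_field K.

(** Moving a coefficient to the left past sigma^i takes its q^i-th root. *)
Lemma skewcoef_star (p : Ktau gamma) i :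
  skewcoef (star hK p) i = iter i (frobq_root gamma hK) (skewcoef p i).
Proof.
rewrite /star skewcoef_sum; under eq_bigr => j _ do rewrite skewXnC skewcoefCM skewcoefXn.
have [ip|pi] := ltnP i (skewsize p); last first.
  rewrite [in RHS]skewcoef_default // iter_phi0 big1 // => j _.
  by rewrite gtn_eqF ?mulr0 //; apply: leq_trans pi.
rewrite (bigD1 (Ordinal ip)) //= eqxx mulr1 big1 ?addr0 // => j /negPf ne.
by rewrite eq_sym [_ == _]ne mulr0.
Qed.

Lemma ltn_skewsize (L : nzRingType) (phi : {rmorphism L -> L}) (p : skewpoly phi) i :
  skewcoef p i != 0 -> (i < skewsize p)%N.
Proof. by apply: contraNltn => pi; rewrite /skewcoef nth_default. Qed.

(** Transposition reverses the order of positions, and the diagonal degrees stay positive because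
    q-th roots of nonzero elements are nonzero. *)
Lemma triangular_star n (T : 'M[Ktau gamma]_n) (pos pos' : 'I_n -> nat) :
  (forall a b, (pos a < pos b)%N -> (pos' b < pos' a)%N) ->
  triangular_wrt T pos -> triangular_wrt (map_mx (star hK) T)^T pos'.
Proof.
move=> pos'P [Ttri Tdiag]; split=> [a b|a]; rewrite !mxE; last first.
  apply: (@leq_ltn_trans (skewsize (T a a)).-1); first by have := Tdiag a; case: skewsize => [|[]].
  apply: ltn_skewsize; rewrite skewcoef_star iter_phi_eq0.
  by case: (skewsize_degree (ltnW (Tdiag a))).
have [->|/Ttri[->|/pos'P]] := eqVneq (T b a) 0; [|by left|by right].
suff -> : star hK (0 : Ktau gamma) = 0 by rewrite eqxx.
by apply: skewcoefP => i; rewrite skewcoef_star !skewcoef0 iter_phi0.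
Qed.
End Star.

(** * Degrees, monomials and a geometric series in K((1/t)) *)

Section LaurentTheory.
Variable K : fieldType.
Implicit Types f g : laurent K.

Definition ldeg (d : int) : set (laurent K) := [set f | forall i, d < i -> f i = 0]%classic.

Lemma exists_ldeg f : exists d : nat, ldeg d f.
Proof.
have [N fN] := lboundP f; exists (absz N) => i Ni; apply: fN.
by apply: le_lt_trans Ni; rewrite abszE ler_norm.
Qed.

Lemma ldeg_le d e f : d <= e -> ldeg d f -> ldeg e f.
Proof. by move=> de fd i ei; apply: fd; apply: le_lt_trans ei. Qed.

Lemma ldeg0 d : ldeg d 0. Proof. by []. Qed.

Lemma ldegD d f g : ldeg d f -> ldeg d g -> ldeg d (f + g).
Proof. by move=> fd gd i di; rewrite lcoefD fd ?gd ?addr0. Qed.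

Lemma ldegM d e f g : ldeg d f -> ldeg e g -> ldeg (d + e) (f * g).
Proof. by move=> fd ge i; apply: lmulcoef_gt. Qed.

Lemma ldeg_sum d I (s : seq I) (P : pred I) (G : I -> laurent K) :
  (forall i, P i -> ldeg d (G i)) -> ldeg d (\sum_(i <- s | P i) G i).
Proof.
by move=> Gd; apply: big_ind => //; apply: ldegD.
Qed.

Lemma lint_ldeg f : lint f -> ldeg 0 f. Proof. by []. Qed.

Lemma lint_mono c d : d <= 0 -> lint (lmono (c : K) d).
Proof. by move=> d0 i i0 /=; rewrite gt_eqF //; apply: le_lt_trans i0. Qed.

Lemma lint0 : lint (0 : laurent K). Proof. by []. Qed.
Lemma lint1 : lint (1 : laurent K). Proof. exact: lint_mono. Qed.
Lemma lintD f g : lint f -> lint g -> lint (f + g). Proof. exact: (@ldegD 0). Qed.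
Lemma lintM f g : lint f -> lint g -> lint (f * g). Proof. exact: (@ldegM 0 0). Qed.

Lemma lcoef_monoM c d f i : (lmono c d * f) i = c * f (i - d).
Proof.
rewrite lcoefM (@fsum_seqE _ _ _ [:: d]) // => [|j]; last first.
  by rewrite inE /= => /negPf ->; rewrite mul0r.
by rewrite big_seq1 /= eqxx.
Qed.

Lemma lmonoM (c c' : K) d d' : lmono c d * lmono c' d' = lmono (c * c') (d + d').
Proof.
apply: laurentP => i; rewrite lcoef_monoM /= subr_eq addrC.
by case: eqP; rewrite ?mulr0 // addrC.
Qed.

Lemma lmono1 : lmono (1 : K) 0 = 1. Proof. by []. Qed.

Lemma lmono_eq0 d : lmono (0 : K) d = 0.
Proof. by apply: laurentP => i /=; case: eqP. Qed.

Lemma lpolyC (c : K) : lpoly c%:P = lmono c 0.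
Proof. by apply: laurentP => -[[|i]|i] //=; rewrite coefC. Qed.

Lemma lpolyX : lpoly 'X = lmono (1 : K) 1.
Proof. by apply: laurentP => -[[|[|i]]|i] //=; rewrite coefX. Qed.

Lemma lpolyXn u : lpoly 'X ^+ u = lmono (1 : K) u%:Z.
Proof.
by elim: u => [|u IH]; rewrite ?expr0 ?lmono1 // exprS IH lpolyX lmonoM mulr1 -intS.
Qed.

Lemma ldeg_mono (c : K) d : ldeg d (lmono c d).
Proof. by move=> i di /=; rewrite gt_eqF. Qed.

(** The coefficients of 1 + c/t + c^2/t^2 + ..., the inverse of 1 - c/t. *)
Lemma lbound_geom (c : K) :
  bounded_above (fun i : int => if i <= 0 then c ^+ absz i else 0).
Proof. by exists 0 => i i0; rewrite leNgt i0. Qed.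
Definition lgeom (c : K) : laurent K := mklaurent (lbound_geom c).

Lemma lint_geom c : lint (lgeom c).
Proof. by move=> i i0 /=; rewrite leNgt i0. Qed.

Lemma lgeomK c : lgeom c * (1 - lmono c (-1)) = 1.
Proof.
rewrite mulrBr mulr1 mulrC; apply: laurentP => i.
rewrite -[in RHS]lmono1 -[_ - _]/(_ + _) lcoefD.
rewrite -[(- _ : laurent K) i]/(- (_ : laurent K) i) lcoef_monoM /= opprK.
have [->|i0] := eqVneq i 0; first by rewrite mulr0 subr0.
have [ip|ip] := ltP 0 i.
  have -> : (i + 1 <= 0) = false by lia.
  by rewrite mulr0 subrr.
have -> : (i + 1 <= 0) = true by lia.
have -> : absz i = (absz (i + 1)).+1 by lia.
by rewrite exprS subrr.
Qed.
End LaurentTheory.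

(** * Base change: generation by tensors and extension of linear forms *)

Section BaseChangeTheory.
Variables (R S : comNzRingType) (iota : {rmorphism R -> S}) (M : lmodType R).
Implicit Types (m : M) (x : basechange iota M).

Lemma tensorE m a : tensor iota m a = a *: tensor iota m 1.
Proof. by rewrite /tensor scale_pi /= mulr1. Qed.

Lemma tensorDl m m' a : tensor iota (m + m') a = tensor iota m a + tensor iota m' a.
Proof. by rewrite /tensor -pi_cat; apply/tens_piP/TensDl. Qed.

Lemma tensorZl c m a : tensor iota (c *: m) a = iota c *: tensor iota m a.
Proof. by rewrite /tensor scale_pi /=; apply/tens_piP/TensZ. Qed.

Lemma tensor0l a : tensor iota (0 : M) a = 0.
Proof. by have := tensorZl 0 0 a; rewrite scale0r rmorph0 scale0r. Qed.

Lemma tensor_suml I (s : seq I) (P : pred I) (G : I -> M) a :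
  tensor iota (\sum_(i <- s | P i) G i) a = \sum_(i <- s | P i) tensor iota (G i) a.
Proof.
by apply: (big_morph (fun m => tensor iota m a)) => [m m'|]; rewrite ?tensorDl ?tensor0l.
Qed.

Lemma pi_tensors (s : seq (M * S)) :
  (\pi_(basechange iota M) s)%qT = \sum_(p <- s) p.2 *: tensor iota p.1 1.
Proof.
elim: s => [|[m a] s IH]; first by rewrite big_nil.
by rewrite big_cons -cat1s pi_cat IH /= -tensorE.
Qed.

Lemma basechange_ind (P : basechange iota M -> Prop) : P 0 ->
  (forall x y, P x -> P y -> P (x + y)) ->
  (forall a m, P (a *: tensor iota m 1)) -> forall x, P x.
Proof.
move=> P0 PD PT x; rewrite -[x]reprK pi_tensors.
by apply: big_ind => // p _; apply: PT.
Qed.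

Section Lift.
Variable f : M -> R.
Hypotheses (fD : forall m m', f (m + m') = f m + f m')
  (fZ : forall c m, f (c *: m) = c * f m).

(** The S-linear extension of f, computed on the chosen representative; [bclift_pi] shows that the
    choice does not matter. *)
Definition bclift x : S := \sum_(p <- repr x) iota (f p.1) * p.2.

Lemma bclift_pi (s : seq (M * S)) :
  bclift (\pi_(basechange iota M) s)%qT = \sum_(p <- s) iota (f p.1) * p.2.
Proof.
rewrite /bclift.
have f0 : f 0 = 0 by rewrite -(scale0r 0) fZ mul0r.
suff E s1 s2 : tens_rel iota s1 s2 ->
    \sum_(p <- s1) iota (f p.1) * p.2 = \sum_(p <- s2) iota (f p.1) * p.2.
  exact/E/tens_reprK.
elim=> {s s1 s2} //=.
- by move=> s1 s2 s3 _ -> _ ->.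
- by move=> s1 s2 s1' s2' _ e _ e'; rewrite !big_cat e e'.
- by move=> s1 s2; rewrite !big_cat /= addrC.
- by move=> x; rewrite big_seq1 big_nil f0 rmorph0 mul0r.
- by move=> m m' x; rewrite !big_cons !big_nil fD rmorphD !addr0 mulrDl.
- by move=> m x x'; rewrite !big_cons !big_nil !addr0 mulrDr.
- by move=> c m x; rewrite !big_seq1 fZ rmorphM mulrCA mulrA.
Qed.

Lemma bcliftD x y : bclift (x + y) = bclift x + bclift y.
Proof.
rewrite -[x]reprK -[y]reprK; rewrite -pi_cat.
by rewrite !bclift_pi big_cat.
Qed.

Lemma bcliftZ a x : bclift (a *: x) = a * bclift x.
Proof.
rewrite -[x]reprK scale_pi !bclift_pi big_map mulr_sumr.
by apply: eq_bigr => p _; rewrite mulrCA.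
Qed.

Lemma bclift_tensor m : bclift (tensor iota m 1) = iota (f m).
Proof. by rewrite /tensor bclift_pi big_seq1 mulr1. Qed.

Lemma bclift_sum I (s : seq I) (P : pred I) (G : I -> basechange iota M) :
  bclift (\sum_(i <- s | P i) G i) = \sum_(i <- s | P i) bclift (G i).
Proof.
have b0 : bclift 0 = 0 by rewrite -(scale0r 0) bcliftZ mul0r.
by apply: (big_morph bclift) => // x y; rewrite bcliftD.
Qed.
End Lift.
End BaseChangeTheory.

(** * Coordinates and the action of tau on the local motive *)

Section LocalMotive.
Variables (F : finFieldType) (K : fieldType) (gamma : {rmorphism {poly F} -> K}).
Variables (n : nat) (Phi : tmodule gamma n) (pos : 'I_n -> nat).
Hypothesis Ttri : triangular_wrt (Phi 'X) pos.

Local Notation T := (Phi 'X).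
Local Notation V := (localmotive Phi).
Local Notation r := (diagrk T).
Local Notation x := (taubasis T).
Local Notation tau := (@localtau F K gamma n Phi).
Local Notation E := (maxsize T).
Implicit Types (z : V) (H : set V).

Definition locbasis a m : V := tensor (@lpoly K) (x a m : motive Phi) 1.
Local Notation y := locbasis.

Definition loccoord a j : V -> laurent K := bclift (fun m : motive Phi => coord Ttri m a j).
Local Notation cc := loccoord.

Lemma loccoordD a j z z' : cc a j (z + z') = cc a j z + cc a j z'.
Proof. by apply: bcliftD; [move=> *; apply: coordD|move=> *; apply: coordZ]. Qed.

Lemma loccoordZ a j c z : cc a j (c *: z) = c * cc a j z.
Proof. by apply: bcliftZ; [move=> *; apply: coordD|move=> *; apply: coordZ]. Qed.

Lemma loccoord_sum a j I (s : seq I) (P : pred I) (G : I -> V) :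
  cc a j (\sum_(i <- s | P i) G i) = \sum_(i <- s | P i) cc a j (G i).
Proof. by apply: bclift_sum; [move=> *; apply: coordD|move=> *; apply: coordZ]. Qed.

Lemma loccoord_basis a j b m : cc a j (y b m) = lpoly (coord Ttri (x b m) a j).
Proof. by apply: bclift_tensor; [move=> *; apply: coordD|move=> *; apply: coordZ]. Qed.

Lemma loccoordE z : z = \sum_a \sum_(j < r a) cc a j z *: y a j.
Proof.
elim/basechange_ind: z => [|z z' IH IH'|c m].
- rewrite big1 // => a _; rewrite big1 // => j _.
  by rewrite -[in cc _ _ _](scale0r (0 : V)) loccoordZ mul0r scale0r.
- rewrite {1}IH {1}IH' -big_split; apply: eq_bigr => a _; rewrite -big_split.
  by apply: eq_bigr => j _; rewrite loccoordD scalerDl.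
- rewrite {1}(coordE Ttri m) tensor_suml scaler_sumr; apply: eq_bigr => a _.
  rewrite tensor_suml scaler_sumr; apply: eq_bigr => j _.
  rewrite tensorZl loccoordZ /loccoord bclift_tensor ?scalerA //.
    by move=> *; apply: coordD.
  by move=> *; apply: coordZ.
Qed.

Lemma localtau_basis a m : tau (y a m) = y a m.+1.
Proof. by rewrite /y localtau_tensor rmorph1 -rowtau_taubasis. Qed.

Lemma iter_localtau_basis v a m : iter v tau (y a m) = y a (v + m).
Proof. by elim: v => //= v ->; rewrite localtau_basis. Qed.

Lemma iter_localtauD v z z' : iter v tau (z + z') = iter v tau z + iter v tau z'.
Proof. by elim: v => //= v ->; rewrite localtauD. Qed.

Lemma iter_localtauZ v c z :
  iter v tau (c *: z) = iter v (lmap (frobq gamma)) c *: iter v tau z.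
Proof. by elim: v => //= v ->; rewrite localtauZ. Qed.

Lemma iter_localtau0 v : iter v tau 0 = 0.
Proof. by rewrite -[in LHS](scale0r (0 : V)) iter_localtauZ iter_phi0 scale0r. Qed.

Lemma ldeg_iter_lmap d v (f : laurent K) : ldeg d f -> ldeg d (iter v (lmap (frobq gamma)) f).
Proof. by move=> fd; elim: v => //= v IH i /IH /= ->; rewrite rmorph0. Qed.

Lemma iter_lmap_mono v d : iter v (lmap (frobq gamma)) (lmono 1 d) = lmono 1 d.
Proof.
elim: v => //= v ->; apply: laurentP => i /=.
by case: eqP; rewrite ?rmorph1 ?rmorph0.
Qed.

Lemma iter_localtau_mono v d z :
  iter v tau (lmono 1 d *: z) = lmono 1 d *: iter v tau z.
Proof. by rewrite iter_localtauZ iter_lmap_mono. Qed.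

Lemma locbasisX a m : lmono 1 1 *: y a m =
  \sum_b \sum_(i < E) lmono (taucoef T a b m i) 0 *: y b (m + i).
Proof.
rewrite -lpolyX -tensorZl taubasisX tensor_suml; apply: eq_bigr => b _.
by rewrite tensor_suml; apply: eq_bigr => i _; rewrite tensorZl /= lpolyC.
Qed.

Lemma locbasis_lead a m : lmono (taucoef T a a m (r a)) 0 *: y a (m + r a) =
  lmono 1 1 *: y a m - \sum_(i < r a) lmono (taucoef T a a m i) 0 *: y a (m + i)
  - \sum_(b | (pos a < pos b)%N) \sum_(i < E) lmono (taucoef T a b m i) 0 *: y b (m + i).
Proof.
rewrite -lpolyC -tensorZl (taubasis_lead Ttri) -lpolyX.
have tN m' : tensor (@lpoly K) (- m' : motive Phi) 1 = - tensor (@lpoly K) m' 1.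
  by rewrite -scaleN1r tensorZl rmorphN1 scaleN1r.
rewrite !tensorDl !tN tensorZl !tensor_suml; congr (_ - _ - _).
  by apply: eq_bigr => i _; rewrite tensorZl /= lpolyC.
apply: eq_bigr => b _; rewrite tensor_suml.
by apply: eq_bigr => i _; rewrite tensorZl /= lpolyC.
Qed.

Local Notation LC := (lincomb (@lint K)).

Lemma lint_lincomb_submodule (B : set V) : submodule_over (@lint K) (LC B).
Proof.
exact: (lincomb_submodule (@lint0 K) (@lintD K) (@lintM K)).
Qed.

(** With [lincomb_min], this reduces an inclusion of f times a span in [H] to the generators of that
    span. *)
Lemma submodule_over_preimZ (f : laurent K) H :
  submodule_over (@lint K) H -> submodule_over (@lint K) [set z | H (f *: z)]%classic.
Proof.
move=> [H0 HD HZ]; split=> /=; first by rewrite scaler0.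
- by move=> z z' Hz Hz'; rewrite scalerDr; apply: HD.
- by move=> c z lc Hz; rewrite scalerA mulrC -scalerA; apply: HZ.
Qed.

(** The map tau^v is only semilinear, but Frobenius sends K[[1/t]] into itself, which suffices for
    the preimage. *)
Lemma submodule_over_preim_tau v H :
  submodule_over (@lint K) H -> submodule_over (@lint K) [set z | H (iter v tau z)]%classic.
Proof.
move=> [H0 HD HZ]; split=> /=; first by rewrite iter_localtau0.
- by move=> z z' Hz Hz'; rewrite iter_localtauD; apply: HD.
- by move=> c z lc Hz; rewrite iter_localtauZ; apply: HZ => //; apply: ldeg_iter_lmap.
Qed.

Lemma lint_submoduleB H z z' : submodule_over (@lint K) H -> H z -> H z' -> H (z - z').
Proof.
case=> _ HD HZ Hz Hz'; rewrite -scaleN1r; apply: HD => //; apply: HZ => //.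
by move=> i i0; rewrite -lmono1 -[LHS]/(- (lmono 1 0 : laurent K) i) /= gt_eqF ?oppr0.
Qed.

(** * Equal ranks imply purity: an explicit lattice *)

Section EqualRanks.
Variable r0 : nat.
Hypotheses (r0_gt0 : (0 < r0)%N) (rE : forall a, r a = r0).

(** Shifts at different positions differ by at least [maxsize], which exceeds the tau-degree of
    every entry, so off-diagonal terms stay within the bounds of the lattice. *)
Definition shift a := (pos a * E)%N.
Local Notation s := shift.

Definition latticegen D : seq V :=
  [seq y a j | a <- index_enum 'I_n, j <- iota 0 (s a + D)].
Definition lattice D : set V := LC [set` latticegen D]%classic.

Lemma mem_lattice D a j : (j < s a + D)%N -> lattice D (y a j).
Proof.
move=> jD; apply: mem_lincomb; first exact: lint1.
by apply/allpairsPdep; exists a, j; rewrite mem_index_enum mem_iota.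
Qed.

Lemma lattice_submodule D : submodule_over (@lint K) (lattice D).
Proof. exact: lint_lincomb_submodule. Qed.

Lemma lattice_min D H : submodule_over (@lint K) H ->
  (forall a j, (j < s a + D)%N -> H (y a j)) -> forall z, lattice D z -> H z.
Proof.
move=> sH yH; apply: lincomb_min => // z /allpairsPdep[a [j [_ + ->]]].
by rewrite mem_iota => /andP[_]; apply: yH.
Qed.

Lemma leq_shift a b : (pos a < pos b)%N -> (s a + E <= s b)%N.
Proof. by move=> ab; rewrite /s -mulSnr leq_mul2r ab orbT. Qed.

Lemma lattice_coefZ D c z : lattice D z -> lattice D (lmono c 0 *: z).
Proof. by apply: submodule_overZ (lattice_submodule D) _ _ _; apply: lint_mono. Qed.

(** The diagonal entry raises the power of tau by at most [r0]; an off-diagonal one raises it by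
    less than [E], which the larger shift at the later index absorbs. *)
Lemma latticeX D z : lattice D z -> lattice (D + r0) (lmono 1 1 *: z).
Proof.
have sL := lattice_submodule (D + r0).
move: z; apply: lattice_min; first exact: submodule_over_preimZ.
move=> a j ja /=; rewrite locbasisX.
apply: (submodule_over_sum sL) => // b _ _; apply: (submodule_over_sum sL) => // i _ _.
have [<-|ab] := eqVneq a b.
  have [ir|ri] := leqP i r0; last by rewrite (taucoef_diag0 Ttri) ?rE // lmono_eq0 scale0r; apply: submodule_over0 sL.
  by apply/lattice_coefZ/mem_lattice; lia.
have [/leq_shift sab|ba] := ltnP (pos a) (pos b).
  by apply/lattice_coefZ/mem_lattice; have := ltn_ord i; lia.
by rewrite (taucoef_eq0 Ttri) // lmono_eq0 scale0r; apply: submodule_over0 sL.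
Qed.

(** Induction on the power j. For j >= s_a + D the recurrence expresses tau^j e_a through t tau^(j -
    r0) e_a, whose quotient by t is a generator, through lower powers at a, and through later
    indices already in the lattice. *)
Lemma lattice_divX D z : (r0 <= D)%N -> lattice (D + r0) z -> lattice D (lmono 1 (-1) *: z).
Proof.
move=> rD; have sL := lattice_submodule D.
move: z; apply: lattice_min; first exact: submodule_over_preimZ.
have lintVX z : lattice D z -> lattice D (lmono 1 (-1) *: z).
  by apply: submodule_overZ sL _ _ _; apply: lint_mono.
move=> a j; elim/ltn_ind: j => j IH ja.
have [jD|Dj] := ltnP j (s a + D); first exact/lintVX/mem_lattice.
(* Here [r0 <= D] ensures that j is large enough for the recurrence. *)
have rj : (r a <= j)%N by rewrite rE; lia.
rewrite -(subnK rj); set k := (j - r a)%N.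
have kE : (k + r0 = j)%N by rewrite /k rE subnK // -(rE a).
have la := taucoef_diag_neq0 Ttri a k.
suff : lattice D (lmono 1 (-1) *: (lmono (taucoef T a a k (r a)) 0 *: y a (k + r a))).
  move/(lattice_coefZ (taucoef T a a k (r a))^-1) => /=.
  by rewrite !scalerA !lmonoM mulr1 add0r addr0 mulVf.
rewrite locbasis_lead !scalerBr; apply: (lint_submoduleB sL); first apply: (lint_submoduleB sL).
- rewrite scalerA lmonoM mulr1 addNr lmono1 scale1r.
  by apply: mem_lattice; lia.
- rewrite scaler_sumr; apply: (submodule_over_sum sL) => // i _ _.
  rewrite scalerA mulrC -scalerA; apply: lattice_coefZ.
  by apply: IH; have := ltn_ord i; have := rE a; lia.
- rewrite scaler_sumr; apply: (submodule_over_sum sL) => // b _ ab.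
  rewrite scaler_sumr; apply: (submodule_over_sum sL) => // i _ _.
  rewrite scalerA mulrC -scalerA; apply/lattice_coefZ/lintVX/mem_lattice.
  by have := leq_shift ab; have := ltn_ord i; lia.
Qed.

(* Downward induction on the power of tau below r0: solving the recurrence for its
   constant term leaves only higher powers, or later indices, times 1/t. *)
Lemma lattice_sub_tau z : lattice (r0 + r0) z -> LC (iter r0 tau @` lattice r0)%classic z.
Proof.
set W := (X in LC X); have sW := @lint_lincomb_submodule W.
move: z; apply: lattice_min => // a j.
have Wtau b m : (r0 <= m)%N -> (m < s b + (r0 + r0))%N -> LC W (y b m).
  move=> rm mb; apply: mem_lincomb; first exact: lint1.
  exists (y b (m - r0)); last by rewrite iter_localtau_basis subnKC.
  by apply: mem_lattice; lia.
(* [triangular_ind] supplies the induction on the index; the power j is treated by a separate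
   induction on [r0 - j]. *)
suff : forall a (m j : nat), (j < s a + (r0 + r0))%N -> LC W (y a j) by move/(_ a 0 j).
apply: triangular_ind pos _ _ => {}a m IHb _ {}j.
have [k] := ubnP (r0 - j); elim: k j => // k IHk j; rewrite ltnS => jk ja.
have [rj|jr] := leqP r0 j; first exact: Wtau.
have WZ c z : LC W z -> LC W (lmono c 0 *: z).
  by apply: submodule_overZ sW _ _ _; apply: lint_mono.
pose c := taucoef T a a j 0.
suff WB : LC W ((1 - lmono c (-1)) *: y a j).
  have := submodule_overZ sW (@lint_geom _ c) WB.
  by rewrite scalerA lgeomK scale1r.
have -> : (1 - lmono c (-1)) *: y a j = lmono 1 (-1) *: (lmono 1 1 *: y a j - lmono c 0 *: y a j).
  by rewrite scalerBr !scalerA !lmonoM mulr1 mul1r addr0 addNr lmono1 -scalerBl.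
have : LC W (lmono 1 1 *: y a j - lmono c 0 *: y a j); last first.
  by apply: submodule_overZ sW _ _ _; apply: lint_mono.
have E_gt0 : (0 < E)%N.
  by apply: leq_trans (leq_maxsize T a a); apply: ltnW; apply: Ttri.2.
rewrite locbasisX (bigD1 a) //= (bigD1 (Ordinal E_gt0)) //= addn0 -/c.
rewrite addrAC [X in X + _]addrAC subrr add0r; apply: (submodule_overD sW).
  apply: (submodule_over_sum sW) => // i _ i0.
  have [ir|ri] := leqP i r0; last first.
    by rewrite (taucoef_diag0 Ttri) ?rE // lmono_eq0 scale0r; apply: submodule_over0 sW.
  have i_gt0 : (0 < i)%N by rewrite lt0n.
  by apply/WZ/IHk; lia.
apply: (submodule_over_sum sW) => // b _ ba; apply: (submodule_over_sum sW) => // i _ _.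
have [/[dup] ab /leq_shift sab|pba] := ltnP (pos a) (pos b).
  by apply/WZ/(IHb b 0%N) => //; have := ltn_ord i; lia.
by rewrite (taucoef_eq0 Ttri) // 1?eq_sym // lmono_eq0 scale0r; apply: submodule_over0 sW.
Qed.

Lemma tau_sub_lattice z : LC (iter r0 tau @` lattice r0)%classic z -> lattice (r0 + r0) z.
Proof.
have sL := lattice_submodule (r0 + r0).
move: z; apply: lincomb_min => // _ [z Lz <-]; move: z Lz.
apply: lattice_min; first exact: submodule_over_preim_tau.
by move=> a j ja /=; rewrite iter_localtau_basis; apply: mem_lattice; lia.
Qed.

Lemma pure_of_equal_ranks : exists H : set V,
    [/\ submodule_over (@lint K) H, fin_generated_over (@lint K) H, generating H
      & exists u v : nat, [/\ (0 < u)%N, (0 < v)%N &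
        ([set lpoly 'X ^+ u *: h | h in H] =
        lincomb (@lint K) (iter v tau @` H))%classic]].
Proof.
exists (lattice r0); split.
- exact: lattice_submodule.
- by exists (latticegen r0).
- apply/seteqP; split=> // z _; rewrite (loccoordE z).
  apply: submodule_over_sum (lincombT_submodule _) _ => a _ _.
  apply: submodule_over_sum (lincombT_submodule _) _ => j _ _.
  apply: (submodule_overZ (lincombT_submodule _)) => //.
  apply: mem_lincomb => //; apply: mem_lattice.
  by have := ltn_ord j; have := rE a; lia.
(* With u = 1 and v = [r0], both sides equal [lattice (r0 + r0)]. *)
exists 1%N, r0; split=> //; rewrite lpolyXn.
apply/seteqP; split=> [_ [z Lz <-]|z /tau_sub_lattice Lz].
  exact/lattice_sub_tau/latticeX.
exists (lmono 1 (-1) *: z); first exact: lattice_divX.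
by rewrite scalerA lmonoM mulr1 subrr lmono1 scale1r.
Qed.
End EqualRanks.
End LocalMotive.

(** * Purity implies equal ranks: growth of the diagonal coordinates *)

Section PureRanks.
Variables (F : finFieldType) (K : fieldType) (gamma : {rmorphism {poly F} -> K}).
Variables (n : nat) (Phi : tmodule gamma n) (pos : 'I_n -> nat).
Hypothesis Ttri : triangular_wrt (Phi 'X) pos.

Local Notation T := (Phi 'X).
Local Notation V := (localmotive Phi).
Local Notation r := (diagrk T).
Local Notation x := (taubasis T).
Local Notation tau := (@localtau F K gamma n Phi).
Local Notation y := (@locbasis F K gamma n Phi).
Local Notation cc := (loccoord Ttri).
Local Notation LC := (lincomb (@lint K)).

Section DiagonalCoord.
Variable k : 'I_n.
Local Notation D m i := (coord Ttri (x k m) k i).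

(** Terms at later indices have no coordinate at k, so only the diagonal entry enters the
    recurrence. *)
Lemma coord_diag_rec m i : (taucoef T k k m (r k))%:P * D (m + r k) i =
  'X * D m i - \sum_(l < r k) (taucoef T k k m l)%:P * D (m + l) i.
Proof.
have c0 : coord Ttri 0 k i = 0 by rewrite -(scale0r (0 : rowmod T)) coordZ mul0r.
have csum I (s : seq I) (P : pred I) (G : I -> rowmod T) :
    coord Ttri (\sum_(l <- s | P l) G l) k i = \sum_(l <- s | P l) coord Ttri (G l) k i.
  by apply: (big_morph (fun z => coord Ttri z k i)) => // z z'; rewrite coordD.
have cN z : coord Ttri (- z) k i = - coord Ttri z k i by rewrite -scaleN1r coordZ mulN1r.
rewrite -coordZ (taubasis_lead Ttri) !coordD !cN (coordZ _ 'X) !csum.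
rewrite [X in _ - X]big1 ?subr0 => [|b kb]; last first.
  rewrite csum big1 // => l _; rewrite coordZ coord_taubasis0 ?mulr0 //; last exact: ltnW.
  by apply: contraTneq kb => ->; rewrite ltnn.
by congr (_ - _); apply: eq_bigr => l _; rewrite coordZ.
Qed.

(** In other words, a nonzero coordinate has t-degree at most (m - i) / r_k, attained when this is a
    natural number: raising m by r_k amounts to one more factor t. *)
Lemma coord_diag_degree m i q : (i < r k)%N ->
  ((m < r k * q + i)%N -> (D m i)`_q = 0) /\ ((r k * q + i)%N = m -> (D m i)`_q != 0).
Proof.
move=> ir; elim/ltn_ind: m q => m IH q.
have [mr|rm] := ltnP m (r k).
  rewrite coord_taubasis // eqxx /=.
  case: q => [|q]; last by rewrite mulnS -polyC_natr coefC; split=> //; lia.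
  rewrite muln0 add0n -polyC_natr coefC /=; split=> [mi|->].
    by rewrite gtn_eqF.
  by rewrite eqxx oner_neq0.
rewrite -(subnK rm); set m' := (m - r k)%N.
have m'E : (m' + r k = m)%N by rewrite subnK.
have r0 := diagrk_gt0 Ttri k.
have lt0 := taucoef_diag_neq0 Ttri k m'.
(* In this range the remaining terms of the recurrence come from smaller m and vanish in degree q by
   induction. *)
have low : (m <= r k * q + i)%N ->
    (taucoef T k k m' (r k)) * (D (m' + r k) i)`_q = ('X * D m' i)`_q.
  move=> mq; rewrite -coefCM coord_diag_rec coefB coef_sum big1 ?subr0 // => l _.
  rewrite coefCM (IH _ _ q).1 ?mulr0 //; have := ltn_ord l; lia.
split=> mq.
  apply/eqP; rewrite -(inj_eq (mulfI lt0)) mulr0 low; last by lia.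
  by rewrite coefXM; case: q mq {low} => //= q mq; rewrite (IH m' _ q).1 //; lia.
rewrite -(inj_eq (mulfI lt0)) mulr0 low; last by lia.
rewrite coefXM; case: q mq {low} => [|q] mq /=; first by lia.
by apply: (IH m' _ q).2; lia.
Qed.

(* By induction on N: the recurrence expresses the last element of the window
   of length r at N + 1 through the window at N, and t - c is invertible. *)
Lemma coord_diag_free N (C : nat -> laurent K) :
  (forall i, (i < r k)%N -> \sum_(j < r k) C j * lpoly (D (N + j) i) = 0) ->
  forall j, (j < r k)%N -> C j = 0.
Proof.
elim: N C => [|N IH] C C0 j jr.
  have := C0 j jr; rewrite (bigD1 (Ordinal jr)) //= coord_taubasis // !eqxx /= rmorph1 mulr1.
  rewrite big1 ?addr0 // => l; rewrite -val_eqE /= => lj.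
  by rewrite add0n coord_taubasis // eqxx /= eq_sym (negPf lj) rmorph0 mulr0.
have r0 := diagrk_gt0 Ttri k.
have rE : (r k).-1.+1 = r k by rewrite prednK.
pose a l := taucoef T k k N l.
have lt0 : a (r k) != 0 by apply: taucoef_diag_neq0 Ttri _ _.
pose c l := lpoly (a l)%:P.
(* Obtained from the relation on the window at N + 1 by multiplying with the leading coefficient and
   eliminating the last element through [coord_diag_rec]. *)
pose C' l := if l is l'.+1 then c (r k) * C l' - c l * C (r k).-1
  else C (r k).-1 * lpoly ('X - (a 0%N)%:P).
have sum_head M (G : nat -> laurent K) : (0 < M)%N ->
    \sum_(l < M) G l = G 0%N + \sum_(l < M.-1) G l.+1.
  by case: M => // M _; rewrite big_ord_recl.
have sum_last M (G : nat -> laurent K) : (0 < M)%N ->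
    \sum_(l < M) G l = \sum_(l < M.-1) G l + G M.-1.
  by case: M => // M _; rewrite big_ord_recr.
have C'0 i : (i < r k)%N -> \sum_(l < r k) C' l * lpoly (D (N + l) i) = 0.
  move=> ir; pose d l := lpoly (D (N + l) i).
  have d_rec : c (r k) * d (r k) = lpoly 'X * d 0%N - (c 0%N * d 0%N +
      \sum_(l < (r k).-1) c l.+1 * d l.+1).
    rewrite -(sum_head _ (fun l => c l * d l) r0) /c /d -rmorphM coord_diag_rec.
    rewrite rmorphB rmorphM rmorph_sum addn0; congr (_ - _).
    by apply: eq_bigr => l _; rewrite rmorphM.
  have Cd : \sum_(l < (r k).-1) C l * d l.+1 + C (r k).-1 * d (r k) = 0.
    rewrite -[RHS](C0 i ir) (sum_last _ (fun j => C j * lpoly (D (N.+1 + j) i)) r0).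
    rewrite addSnnS rE; congr (_ + _).
    by apply: eq_bigr => l _; rewrite addSnnS.
  rewrite (sum_head _ (fun l => C' l * d l) r0) /=.
  have -> : \sum_(l < (r k).-1) (c (r k) * C l - c l.+1 * C (r k).-1) * d l.+1 =
      c (r k) * \sum_(l < (r k).-1) C l * d l.+1 -
      C (r k).-1 * \sum_(l < (r k).-1) c l.+1 * d l.+1.
    by rewrite !mulr_sumr -sumrB; apply: eq_bigr => l _; ring.
  have -> : \sum_(l < (r k).-1) C l * d l.+1 = - (C (r k).-1 * d (r k)).
    by apply/eqP; rewrite -addr_eq0 Cd.
  have -> : \sum_(l < (r k).-1) c l.+1 * d l.+1 =
      lpoly 'X * d 0%N - c 0%N * d 0%N - c (r k) * d (r k).
    by rewrite d_rec; ring.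
  by rewrite rmorphB /= -/(c 0%N); ring.
have {}C'0 := IH _ C'0.
(* [C' 0] is this coefficient times t - a_0 = t (1 - a_0/t), which 1/t and a geometric series
   invert. *)
have Cr0 : C (r k).-1 = 0.
  have := C'0 0%N r0; rewrite /= rmorphB /= lpolyX lpolyC.
  move/(congr1 (fun f => f * lmono 1 (-1) * lgeom (a 0%N))).
  rewrite !mul0r -!mulrA -[X in _ * X](_ : 1 = _) ?mulr1 //.
  rewrite mulrA mulrBl !lmonoM mulr1 mulr1 subrr lmono1 add0r mulrC.
  by rewrite lgeomK.
have [jr'|] := ltnP j (r k).-1; last by move=> h; have -> : j = (r k).-1 by lia.
have : C' j.+1 = 0 by apply: C'0; lia.
rewrite /= Cr0 mulr0 subr0 => /(congr1 (fun f => lmono (a (r k))^-1 0 * f)).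
by rewrite mulr0 mulrA /c lpolyC lmonoM mulVf // addr0 lmono1 mul1r.
Qed.
End DiagonalCoord.

Lemma loccoord_basis0 a b m j : a != b -> (pos a <= pos b)%N -> cc a j (y b m) = 0.
Proof. by move=> ab le_ab; rewrite loccoord_basis coord_taubasis0 // rmorph0. Qed.

Lemma exists_loccoord_bound (z : V) : exists b : nat, forall a j, ldeg b (cc a j z).
Proof.
pose d a j : nat := sval (cid (exists_ldeg (cc a j z))).
exists (\max_a \max_(j < r a) d a j) => a j.
have [aj|ja] := leqP (r a) j.
  have -> : cc a j z = 0; last exact: ldeg0.
  rewrite (loccoordE Ttri z) loccoord_sum big1 // => b _.
  rewrite loccoord_sum big1 // => i _.
  by rewrite loccoordZ loccoord_basis coord_default // rmorph0 mulr0.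
apply: (ldeg_le (d := d a j)); last by rewrite /d; case: cid.
rewrite lez_nat; apply: leq_trans (leq_bigmax (F := fun a => \max_(j < r a) d a j) a).
exact: (leq_bigmax (F := fun j : 'I_(r a) => d a j) (Ordinal ja)).
Qed.

(** * Comparison of slopes for a lattice witnessing purity *)

Section Pure.
Variables (H : set V) (u v : nat).
Hypotheses (sH : submodule_over (@lint K) H) (fgH : fin_generated_over (@lint K) H)
  (gH : generating H).
Hypothesis HE :
  ([set lpoly 'X ^+ u *: h | h in H] = LC (iter v tau @` H))%classic.

(** A common bound for the finitely many generators persists because elements of K[[1/t]] have
    degree at most 0. *)
Lemma pure_bound : exists b : nat, forall h, H h -> forall a j, ldeg b (cc a j h).
Proof.
have [s ->] := fgH.
have [b bP] : exists b : nat, forall z, z \in s -> forall a j, ldeg b (cc a j z).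
  elim: s => [|z s [b IH]]; first by exists 0%N.
  have [b' b'P] := exists_loccoord_bound z; exists (maxn b b') => w.
  rewrite inE => /predU1P[->|ws] a j.
    by apply: ldeg_le (b'P a j); rewrite lez_nat leq_maxr.
  by apply: ldeg_le (IH w ws a j); rewrite lez_nat leq_maxl.
exists b; apply: lincomb_min => //; split.
- by move=> a j; rewrite -(scale0r (0 : V)) loccoordZ mul0r.
- by move=> z z' Hz Hz' a j; rewrite loccoordD; apply: ldegD.
- move=> c z /lint_ldeg c0 Hz a j; rewrite loccoordZ -[b%:Z]add0r.
  exact: ldegM.
Qed.

(** Since [H] generates over K((1/t)), a power of 1/t brings the finitely many coefficients into
    K[[1/t]]. *)
Lemma pure_absorbs z : exists a : nat, H (lmono 1 (- a%:Z) *: z).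
Proof.
have le_absorb (a a' : nat) w : (a <= a')%N -> H (lmono 1 (- a%:Z) *: w) ->
    H (lmono 1 (- a'%:Z) *: w).
  move=> aa' Hw; have -> : lmono 1 (- a'%:Z) = lmono (1 : K) (- (a' - a)%:Z) * lmono 1 (- a%:Z).
    by rewrite lmonoM mulr1; congr lmono; lia.
  by rewrite -scalerA; apply: (submodule_overZ sH) => //; apply: lint_mono; lia.
have : lincomb setT H z by rewrite gH.
move: z; apply: lincomb_min => [|z Hz]; last first.
  by exists 0%N; rewrite oppr0 lmono1 scale1r.
split.
- by exists 0%N; rewrite scaler0; apply: submodule_over0 sH.
- move=> z z' [a Ha] [a' Ha']; exists (maxn a a').
  rewrite scalerDr; apply: (submodule_overD sH).
    by apply: le_absorb Ha; apply: leq_maxl.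
  by apply: le_absorb Ha'; apply: leq_maxr.
- move=> c z _ [a Ha]; have [d cd] := exists_ldeg c; exists (a + d)%N.
  rewrite scalerA.
  have -> : lmono 1 (- (a + d)%:Z) * c = (lmono 1 (- d%:Z) * c) * lmono 1 (- a%:Z).
    rewrite mulrAC lmonoM mulr1; congr (lmono _ _ * _); lia.
  rewrite -scalerA; apply: (submodule_overZ sH) => //.
  have := ldegM (@ldeg_mono _ 1 (- d%:Z)) cd.
  by rewrite addNr.
Qed.

(** Iterates one inclusion of [HE], using that tau commutes with powers of t. *)
Lemma pure_iter_tau m h : H h ->
  exists2 h', H h' & iter (v * m) tau h = lmono 1 (u * m)%:Z *: h'.
Proof.
move=> Hh; elim: m => [|m [h' Hh' IH]].
  by exists h; rewrite ?muln0 ?lmono1 ?scale1r.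
have : ([set lpoly 'X ^+ u *: h | h in H])%classic (iter v tau h').
  by rewrite HE; apply: mem_lincomb; [exact: lint1|exists h'].
case=> h'' Hh'' e; exists h'' => //.
rewrite mulnS iterD IH iter_localtau_mono -e lpolyXn scalerA lmonoM mulr1.
by congr (lmono _ _ *: _); lia.
Qed.

(** The other inclusion of [HE], iterated; a span appears because the image of [H] under a power of
    tau may fail to be a submodule. *)
Lemma pure_sub_iter m h : H h ->
  LC (iter (v * m) tau @` H)%classic (lmono 1 (u * m)%:Z *: h).
Proof.
move=> Hh; elim: m => [|m IH].
  by rewrite !muln0 lmono1 scale1r; apply: mem_lincomb; [exact: lint1|exists h].
set W := (X in LC X); have sW := @lint_lincomb_submodule _ _ _ _ Phi W.
have -> : lmono 1 (u * m.+1)%:Z *: h = lmono 1 u%:Z *: (lmono 1 (u * m)%:Z *: h).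
  by rewrite scalerA lmonoM mulr1; congr (lmono _ _ *: _); lia.
move: (lmono 1 (u * m)%:Z *: h) IH; apply: lincomb_min.
  exact: submodule_over_preimZ.
move=> _ [h0 Hh0 <-]; rewrite /= -iter_localtau_mono.
have : LC (iter v tau @` H)%classic (lmono 1 u%:Z *: h0).
  by rewrite -HE; exists h0; rewrite ?lpolyXn.
move: (lmono 1 u%:Z *: h0); apply: lincomb_min; first exact: submodule_over_preim_tau.
move=> _ [h1 Hh1 <-]; rewrite /= -iterD; apply: mem_lincomb; first exact: lint1.
by exists h1; rewrite // mulnS addnC.
Qed.

(** Linear growth rates can be compared up to a bounded error. *)
Lemma leq_mul_bound p q b : (forall m, (p * m <= q * m + b)%N) -> (p <= q)%N.
Proof. by move=> h; rewrite leqNgt; apply/negP => qp; have := h b.+1; nia. Qed.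

Lemma pure_ge_slope k : (v <= u * r k)%N.
Proof.
have [b bP] := pure_bound; have [a Ha] := pure_absorbs (y k 0).
apply: (@leq_mul_bound _ _ (a + b)) => m.
have rk0 := diagrk_gt0 Ttri k.
(* The factor [r k] makes the exponent of tau divisible by [r k], so that the coordinate (k, 0) has
   degree exactly [v * m]. *)
have [h Hh] := pure_iter_tau (r k * m) Ha.
rewrite iter_localtau_mono iter_localtau_basis addn0.
move/(congr1 (fun z => cc k 0%N (lmono 1 a%:Z *: z))).
rewrite scalerA lmonoM mulr1 subrr lmono1 scale1r scalerA lmonoM mulr1 loccoordZ loccoord_basis.
move/(congr1 (fun f : laurent K => f (v * m)%:Z)) => /= e.
have /eqP lead : (coord Ttri (x k (v * (r k * m))) k 0)`_(v * m) != 0.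
  by apply: (coord_diag_degree _ _ rk0).2; rewrite addn0 mulnCA.
rewrite leqNgt; apply/negP => lt_m; apply: lead; rewrite e.
by apply: (ldegM (@ldeg_mono _ _ _) (bP _ Hh k 0%N)); lia.
Qed.

Lemma pure_le_slope k : (u * r k <= v)%N.
Proof.
have [b bP] := pure_bound; have [a Ha] := pure_absorbs (y k 0).
apply: (@leq_mul_bound _ _ (a + b)) => m.
have rk0 := diagrk_gt0 Ttri k.
pose N := (v * (r k * m))%N.
(* The coefficients come from expanding elements of [H] before applying tau^N; Frobenius preserves
   their degree bound b. *)
have [C Cb CE] : exists2 C : 'I_n -> nat -> laurent K, forall i j, ldeg b (C i j) &
    lmono 1 (u * (r k * m))%:Z *: (lmono 1 (- a%:Z) *: y k 0) =
    \sum_i \sum_(j < r i) C i j *: y i (N + j).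
  move: (lmono 1 (u * (r k * m))%:Z *: _) (pure_sub_iter (r k * m) Ha).
  apply: lincomb_min.
    split.
    - exists (fun _ _ => 0) => //; rewrite big1 // => i _; rewrite big1 // => j _.
      by rewrite scale0r.
    - move=> _ _ [C Cb ->] [C' C'b ->]; exists (fun i j => C i j + C' i j).
        by move=> i j; apply: ldegD.
      rewrite -big_split; apply: eq_bigr => i _; rewrite -big_split.
      by apply: eq_bigr => j _; rewrite scalerDl.
    - move=> c _ /lint_ldeg c0 [C Cb ->]; exists (fun i j => c * C i j).
        by move=> i j; rewrite -[b%:Z]add0r; apply: ldegM.
      rewrite scaler_sumr; apply: eq_bigr => i _; rewrite scaler_sumr.
      by apply: eq_bigr => j _; rewrite scalerA.
  move=> _ [h Hh <-]; exists (fun i j => iter N (lmap (frobq gamma)) (cc i j h)).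
    by move=> i j; apply: ldeg_iter_lmap; apply: bP.
  rewrite {1}(loccoordE Ttri h).
  rewrite (big_morph _ (iter_localtauD (Phi := Phi) N) (iter_localtau0 Phi N)); apply: eq_bigr => i _.
  rewrite (big_morph _ (iter_localtauD (Phi := Phi) N) (iter_localtau0 Phi N)); apply: eq_bigr => j _.
  by rewrite iter_localtauZ iter_localtau_basis.
have ccE i l : (pos i <= pos k)%N ->
    (forall i' j, (pos i' < pos i)%N -> (j < r i')%N -> C i' j = 0) ->
    cc i l (\sum_i \sum_(j < r i) C i j *: y i (N + j)) =
    \sum_(j < r i) C i j * lpoly (coord Ttri (x i (N + j)) i l).
  move=> ik Ci; rewrite loccoord_sum (bigD1 i) //= [X in _ + X]big1 ?addr0.
    by rewrite loccoord_sum; apply: eq_bigr => j _; rewrite loccoordZ loccoord_basis.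
  move=> i' i'i; rewrite loccoord_sum big1 // => j _; rewrite loccoordZ.
  have [ii'|/Ci ->] := leqP (pos i) (pos i'); rewrite ?mul0r //.
  by rewrite loccoord_basis0 ?mulr0 // eq_sym.
(* As e_k has no coordinate at earlier positions, [coord_diag_free] kills the coefficients there,
   one position after another. *)
have C0 i j : (pos i < pos k)%N -> (j < r i)%N -> C i j = 0.
  have [p] := ubnP (pos i); elim: p i j => // p IH i j; rewrite ltnS => ip ik.
  apply: (coord_diag_free (k := i) (N := N) (C := C i)) => l il.
  rewrite -(ccE i l (ltnW ik)) => [|i' j' i'i].
    rewrite -CE !loccoordZ loccoord_basis0 ?mulr0 //; last exact: ltnW.
    by apply: contraTneq ik => ->; rewrite ltnn.
  by apply: IH; [apply: leq_trans i'i ip|apply: ltn_trans i'i ik].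
have := congr1 (cc k 0%N) CE; rewrite ccE // !loccoordZ loccoord_basis coord_taubasis //.
rewrite !eqxx rmorph1 mulr1 lmonoM mulr1.
move/(congr1 (fun f : laurent K => f ((u * (r k * m))%:Z - a%:Z))) => /=; rewrite eqxx.
move=> e; rewrite leqNgt; apply/negP => lt_m; move/eqP: e.
rewrite [X in _ == X](_ : _ = 0) ?oner_eq0 //.
(* For [j < r k] one has N + j < r_k (v m + 1), so the coordinates involved have degree at most
   [v * m]. *)
apply: (@ldeg_sum _ (b%:Z + (v * m)%:Z)); last by lia.
move=> j _; apply: ldegM => // -[q|q] //=; rewrite ltz_nat => mq.
by apply: (coord_diag_degree _ _ rk0).1; rewrite /N; have := ltn_ord j; nia.
Qed.

Lemma pure_slope k : (u * r k = v)%N.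
Proof. by apply/eqP; rewrite eqn_leq pure_le_slope pure_ge_slope. Qed.
End Pure.
End PureRanks.

(** * The matrix of a triangular t-module and the final assembly *)

Lemma triangular_mx_triangular_wrt (F : finFieldType) (K : fieldType)
    (gamma : {rmorphism {poly F} -> K}) n (psi : 'I_n -> drinfeld gamma)
    (delta : 'I_n -> 'I_n -> Ktau gamma) :
  triangular_wrt (triangular_mx psi delta) (fun a => rev_ord a).
Proof.
split=> [a b|a]; rewrite mxE /=; last by rewrite eqxx; apply: drinfeld_pos.
have [/rev_ord_inj -> _|_] := eqVneq (rev_ord a) (rev_ord b); first by left.
by case: ifP => [ab _|_]; [right|rewrite eqxx].
Qed.

Lemma diagrk_triangular_mx (F : finFieldType) (K : fieldType)
    (gamma : {rmorphism {poly F} -> K}) n (psi : 'I_n -> drinfeld gamma)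
    (delta : 'I_n -> 'I_n -> Ktau gamma) i :
  diagrk (triangular_mx psi delta) i = rk (psi (rev_ord i)).
Proof. by rewrite /diagrk mxE /= eqxx. Qed.

Theorem theorem7p6 (F : finFieldType) (K : fieldType)
    (gamma : {rmorphism {poly F} -> K}) (n : nat) (hn : (0 < n)%N)
    (psi : 'I_n -> drinfeld gamma) (delta : 'I_n -> 'I_n -> Ktau gamma)
    (Upsilon : tmodule gamma n) (hU : is_triangular psi delta Upsilon) :
  ((forall hK : perfect_field K, tmod_finite hK Upsilon) /\ tmod_abelian Upsilon) /\
  (tmod_pure Upsilon <-> forall i j : 'I_n, rk (psi i) = rk (psi j)).
Proof.
(* The position [rev_ord a] is the label of row a minus one: a nonzero off-diagonal entry has
   smaller row label than column label. *)
have Ttri : triangular_wrt (Upsilon 'X) (fun a => rev_ord a).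
  by rewrite hU; apply: triangular_mx_triangular_wrt.
have rkE i : diagrk (Upsilon 'X) i = rk (psi (rev_ord i)).
  by rewrite hU; apply: diagrk_triangular_mx.
have abel : tmod_abelian Upsilon.
  by split; [apply: triangular_free Ttri|apply: triangular_fin_generated Ttri].
split; first split=> // hK.
  (* Since transposition reverses the order, the index itself serves as position for the
     comotive. *)
  have Ttri' : triangular_wrt (map_mx (star hK) (Upsilon 'X))^T (fun a => a).
    by apply: triangular_star Ttri => a b /=; have := ltn_ord a; have := ltn_ord b; lia.
  by split; [apply: triangular_free Ttri'|apply: triangular_fin_generated Ttri'].
split=> [[_ [H [sH fgH gH [u [v [u0 _ HE]]]]]] i j|rk_eq].
  have slope k : (u * rk (psi k) = v)%N.
    by rewrite -(pure_slope Ttri sH fgH gH HE (rev_ord k)) rkE rev_ordK.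
  by apply/eqP; rewrite -(eqn_pmul2l u0) !slope.
(* Positivity of n provides an index at which to read off the common rank. *)
split=> //; pose i0 := Ordinal hn.
apply: (pure_of_equal_ranks Ttri (r0 := rk (psi i0))) => [|a]; last by rewrite rkE.
by rewrite -(rev_ordK i0) -rkE; apply: diagrk_gt0 Ttri _.
Qed.
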